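(* Let $\Lambda=\{1,\dots,N\}$ with $N\ge2$, $\delta_i>0$ for $i\in\Lambda$, and $\gamma:\Lambda\times\Lambda\to[0,+\infty]$ with $\gamma_{ij}=\gamma_{ji}$, $\gamma_{ii}=0$. Let $P$ be the Gibbs measure on $\mathbb{N}^\Lambda$ $$P(x_1,\dots,x_N)=\frac1C\,\mathrm{e}^{-\sum_{i<j}\gamma_{ij}x_ix_j}\prod_{i=1}^N\mathcal{P}(\delta_i)(x_i),$$ with $C$ the normalizing constant. Assume Dobrushin's uniqueness condition $$D:=\sup_{j\in\Lambda}\sum_{i\in\Lambda}\delta_i(1-\mathrm{e}^{-\gamma_{ij}})<1.$$ Let $\rho_H(x_\Lambda,y_\Lambda)=\sum_{i\in\Lambda}|x_i-y_i|$ on $\mathbb{N}^\Lambda$ and $c=\sum_{i\in\Lambda}(\delta_i+\delta_i^2/4)$. Then $$h_c\big((1-D)\,W_{1,\rho_H}(Q,P)\big)\le H(Q|P)\qquad\text{for all }Q\in\mathcal{M}_1(\mathbb{N}^\Lambda).$$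
   Context: Conventions: $0\cdot\infty=0$, $\mathrm{e}^{-\infty}=0$. $\mathcal{P}(\lambda)(k)=\mathrm{e}^{-\lambda}\lambda^k/k!$. $W_{1,d}(\mu,\nu)=\inf_\pi\int\!\!\int d(x,y)\,\mathrm{d}\pi(x,y)$ over couplings $\pi$ of $\mu,\nu$. $H(\nu|\mu)=\int\log\frac{\mathrm{d}\nu}{\mathrm{d}\mu}\,\mathrm{d}\nu$ if $\nu\ll\mu$, $+\infty$ otherwise. $h(r)=(1+r)\log(1+r)-r$, $h_c(r)=c\,h(r/c)$ for $c>0$. *)

(* Defs.v *)
From Stdlib Require Import Reals List Arith Factorial.
Import ListNotations.
Open Scope R_scope.

Definition fsum {X : Type} (f : X -> R) (l : list X) : R :=
  fold_right (fun x acc => f x + acc) 0 l.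

(** For nonnegative f: the (finite) series sum_x f x equals s. *)
Definition has_sum_nn {X : Type} (f : X -> R) (s : R) : Prop :=
  is_lub (fun r => exists l : list X, NoDup l /\ r = fsum f l) s.

Definition has_sum {X : Type} (f : X -> R) (s : R) : Prop :=
  exists sp sn, has_sum_nn (fun x => Rmax (f x) 0) sp /\
                has_sum_nn (fun x => Rmax (- f x) 0) sn /\ s = sp - sn.

Definition is_glb (E : R -> Prop) (m : R) : Prop :=
  (forall x, E x -> m <= x) /\ (forall b, (forall x, E x -> b <= x) -> b <= m).

(** Configurations in N^Lambda, Lambda = {1..N} encoded as indices 0..N-1. *)
Definition config (N : nat) := { l : list nat | length l = N }.
Definition coord {N : nat} (x : config N) (i : nat) : nat := nth i (proj1_sig x) 0%nat.

(** [0,+oo] : None = +oo. *)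
Definition ereal_nn := option R.

(** e^{- g * k} with conventions 0*oo = 0, e^{-oo} = 0. *)
Definition exp_neg_mul (g : ereal_nn) (k : nat) : R :=
  match g with
  | Some r => exp (- (r * INR k))
  | None => match k with O => 1 | S _ => 0 end
  end.

Definition one_minus_exp_neg (g : ereal_nn) : R := 1 - exp_neg_mul g 1.

Definition poisson (lam : R) (k : nat) : R := exp (- lam) * lam ^ k / INR (fact k).

Definition sum_idx (N : nat) (f : nat -> R) : R := fsum f (seq 0 N).

Definition gibbs_weight (N : nat) (delta : nat -> R) (gamma : nat -> nat -> ereal_nn)
    (x : config N) : R :=
  fold_right Rmult 1
    (map (fun j => fold_right Rmult 1
            (map (fun i => exp_neg_mul (gamma i j) (coord x i * coord x j)) (seq 0 j)))
         (seq 0 N))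
  * fold_right Rmult 1 (map (fun i => poisson (delta i) (coord x i)) (seq 0 N)).

Definition dobrushin (N : nat) (delta : nat -> R) (gamma : nat -> nat -> ereal_nn) : R :=
  fold_right Rmax 0
    (map (fun j => sum_idx N (fun i => delta i * one_minus_exp_neg (gamma i j))) (seq 0 N)).

Definition rhoH {N : nat} (x y : config N) : R :=
  sum_idx N (fun i => Rabs (INR (coord x i) - INR (coord y i))).

Definition is_prob {X : Type} (Q : X -> R) : Prop :=
  (forall x, 0 <= Q x) /\ has_sum Q 1.

Definition is_coupling {X : Type} (Q P : X -> R) (pi : X * X -> R) : Prop :=
  (forall xy, 0 <= pi xy) /\
  (forall x, has_sum (fun y => pi (x, y)) (Q x)) /\
  (forall y, has_sum (fun x => pi (x, y)) (P y)).

Definition W1_costs {X : Type} (d : X -> X -> R) (Q P : X -> R) (w : R) : Prop :=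
  exists pi, is_coupling Q P pi /\ has_sum (fun xy => pi xy * d (fst xy) (snd xy)) w.

Definition rel_entropy {X : Type} (Q P : X -> R) (Hv : R) : Prop :=
  (forall x, P x = 0 -> Q x = 0) /\
  has_sum (fun x => if Req_EM_T (Q x) 0 then 0 else Q x * ln (Q x / P x)) Hv.

Definition h_fun (r : R) : R := (1 + r) * ln (1 + r) - r.
Definition h_c (c r : R) : R := c * h_fun (r / c).

(* Main.v *)
Require Import Defs.
From Coquelicot Require Import Hierarchy Derive AutoDerive.
From Stdlib Require Import Reals List FinFun Lra Lia Classical ClassicalEpsilon
  FunctionalExtensionality Factorial.
Import ListNotations.
Open Scope R_scope.

(** By Kantorovich duality (Farkas' lemma on a finite set of configurations, after collapsing its
    complement to one point) and the entropy inequality [q g <= q ln (q / p) - q + p e^g], it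
    suffices to bound the Laplace transform of every 1-Lipschitz [F] under the Gibbs measure [P]:
    [P e^{t (F - P F)} <= exp (c h*(t / (1 - D)))], where [h*(t) = e^t - 1 - t].

    Conditioning on the last coordinate being [n] leaves a Gibbs measure with activities
    [delta_i e^{- gamma_iN n}], so one can argue by induction on [N].  The conditional
    expectation of [F] is [1 / (1 - D)]-Lipschitz in [n] by Dobrushin's comparison argument, and
    the law of the last coordinate is a mixture of Poisson laws with parameters in
    [[0, delta_N]]: the Laplace bound for Poisson laws gives the contribution [delta_N] to [c],
    and Hoeffding's lemma for the mixing law, with [t^2 / 2 <= h*(t)], gives [delta_N^2 / 4].
    The bounds for Poisson laws are limits of those for binomial laws, which tensorise. *)

(** * Finite sums *)

(** The factor [1 / (1 - D)] must not compound over the sites. In the induction the hypothesis is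
    applied to the slices of [F] at a fixed last coordinate, which are again 1-Lipschitz, and the
    conditional activities are at most the original ones, so the bound [D] persists and the sum
    defining [c] can only decrease. The factor enters only through the function of one variable left
    after averaging a slice: changing the last coordinate by 1 moves the slice by at most 1, and it
    moves the activities by at most [D] in total, which by the comparison argument costs
    [D / (1 - D)]; the sum is [1 / (1 - D)]. The function [h*] is the logarithmic Laplace transform
    of the centred Poisson law of parameter 1, and the Legendre transform of [c h*] is [h_c]: the
    best [t] produces the left side of the inequality. The configuration space is infinite, so
    duality is proved up to an arbitrary error: collapsing the complement of a finite set costs the
    tails of the first moments. That of [Q] is finite because its entropy is. The error is harmless
    because [W] is an infimum. *)

Lemma Rabs_le_inv x y : Rabs x <= y -> - y <= x <= y.
Proof. unfold Rabs; destruct Rcase_abs; lra. Qed.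

Lemma fsum_ext {X} (f g : X -> R) l :
  (forall x, In x l -> f x = g x) -> fsum f l = fsum g l.
Proof.
  induction l as [|x l IH]; intros H; simpl; [reflexivity|].
  rewrite (H x), IH; auto with datatypes.
Qed.

Lemma fsum_le {X} (f g : X -> R) l :
  (forall x, In x l -> f x <= g x) -> fsum f l <= fsum g l.
Proof.
  induction l as [|x l IH]; intros H; simpl; [lra|].
  apply Rplus_le_compat; auto with datatypes.
Qed.

Lemma fsum_plus {X} (f g : X -> R) l :
  fsum (fun x => f x + g x) l = fsum f l + fsum g l.
Proof. induction l as [|x l IH]; simpl; [lra|]. rewrite IH; lra. Qed.

Lemma fsum_scal {X} (c : R) (f : X -> R) l :
  fsum (fun x => c * f x) l = c * fsum f l.
Proof. induction l as [|x l IH]; simpl; [lra|]. rewrite IH; lra. Qed.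

Lemma fsum_zero {X} (f : X -> R) l :
  (forall x, In x l -> f x = 0) -> fsum f l = 0.
Proof.
  induction l as [|x l IH]; intros H; simpl; [lra|].
  rewrite (H x), IH; auto with datatypes; lra.
Qed.

Lemma fsum_nonneg {X} (f : X -> R) l :
  (forall x, In x l -> 0 <= f x) -> 0 <= fsum f l.
Proof.
  intros H. rewrite <- (fsum_zero (fun _ : X => 0) l) by auto.
  apply fsum_le; auto.
Qed.

Lemma fsum_app {X} (f : X -> R) l l' : fsum f (l ++ l') = fsum f l + fsum f l'.
Proof. induction l as [|x l IH]; simpl; [lra|]. rewrite IH; lra. Qed.

Lemma fsum_map {X Y} (f : Y -> R) (g : X -> Y) l :
  fsum f (map g l) = fsum (fun x => f (g x)) l.
Proof. induction l as [|x l IH]; simpl; [lra|]. rewrite IH; lra. Qed.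

Lemma fsum_list_prod {X Y} (f : X * Y -> R) A B :
  fsum f (list_prod A B) = fsum (fun x => fsum (fun y => f (x, y)) B) A.
Proof.
  induction A as [|x A IH]; simpl; [lra|].
  rewrite fsum_app, fsum_map, IH; lra.
Qed.

Lemma fsum_swap {X Y} (f : X -> Y -> R) A B :
  fsum (fun x => fsum (f x) B) A = fsum (fun y => fsum (fun x => f x y) A) B.
Proof.
  induction A as [|x A IH]; simpl.
  - rewrite fsum_zero; auto.
  - now rewrite IH, <- fsum_plus.
Qed.

Lemma fsum_incl {X} (f : X -> R) l l' :
  (forall x, 0 <= f x) -> NoDup l -> incl l l' -> fsum f l <= fsum f l'.
Proof.
  intros Hf Hl. revert l'. induction Hl as [|x l Hx Hl IH]; intros l' Hi; simpl.
  - apply fsum_nonneg; auto.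
  - destruct (in_split x l' (Hi x (or_introl eq_refl))) as (l1 & l2 & ->).
    assert (H : fsum f l <= fsum f (l1 ++ l2)).
    { apply IH. intros y Hy. specialize (Hi y (or_intror Hy)).
      apply in_app_or in Hi. apply in_or_app. destruct Hi as [Hi|[->|Hi]]; tauto. }
    rewrite fsum_app in *. simpl. lra.
Qed.

Definition eq_dec_cl {X} (x y : X) : {x = y} + {x <> y} :=
  excluded_middle_informative (x = y).

Definition undup {X} (l : list X) : list X := nodup eq_dec_cl l.

Lemma undup_NoDup {X} (l : list X) : NoDup (undup l).
Proof. apply NoDup_nodup. Qed.

Lemma undup_incl {X} (l l' : list X) : incl l l' -> incl l (undup l').
Proof. intros H x Hx. apply nodup_In. auto. Qed.

Definition indic (p : Prop) : R := if excluded_middle_informative p then 1 else 0.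

Lemma indic_true (p : Prop) : p -> indic p = 1.
Proof. unfold indic; destruct excluded_middle_informative; tauto. Qed.

Lemma indic_false (p : Prop) : ~ p -> indic p = 0.
Proof. unfold indic; destruct excluded_middle_informative; tauto. Qed.

Lemma fsum_indic_eq {X} (f : X -> R) x l :
  NoDup l -> In x l -> fsum (fun y => indic (x = y) * f y) l = f x.
Proof.
  intros Hl Hx. induction Hl as [|y l Hy Hl IH]; [destruct Hx|]. simpl.
  destruct Hx as [->|Hx].
  - rewrite indic_true, fsum_zero; auto; [lra|].
    intros z Hz. rewrite indic_false; [lra|congruence].
  - rewrite indic_false, IH; auto; [lra|congruence].
Qed.

(** * Unordered sums *)

(** Convergence along the net of finite sets ordered by inclusion. Unlike [has_sum], which splits a
    function into positive and negative parts, this notion is linear by construction; it agrees with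
    [has_sum_nn] on nonnegative functions. *)
Definition HS {X} (f : X -> R) (s : R) : Prop :=
  forall eps, 0 < eps -> exists l0, forall l, NoDup l -> incl l0 l ->
    Rabs (fsum f l - s) < eps.

Definition summable {X} (f : X -> R) : Prop :=
  exists M, forall l, NoDup l -> fsum (fun x => Rabs (f x)) l <= M.

(** Made total by choice: its value is meaningful only where a sum is known to exist, hence the
    summability hypotheses below. *)
Definition tsum {X} (f : X -> R) : R := epsilon (inhabits 0) (HS f).

Lemma HS_unique {X} (f : X -> R) s s' : HS f s -> HS f s' -> s = s'.
Proof.
  intros H H'. apply cond_eq. intros e He.
  destruct (H (e / 2)) as [l Hl]; [lra|]. destruct (H' (e / 2)) as [l' Hl']; [lra|].
  specialize (Hl (undup (l ++ l')) (undup_NoDup _) (undup_incl _ _ (incl_appl _ (incl_refl _)))).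
  specialize (Hl' (undup (l ++ l')) (undup_NoDup _) (undup_incl _ _ (incl_appr _ (incl_refl _)))).
  apply Rabs_def2 in Hl. apply Rabs_def2 in Hl'. apply Rabs_def1; lra.
Qed.

Lemma HS_tsum {X} (f : X -> R) s : HS f s -> tsum f = s.
Proof.
  intros H. apply (HS_unique f); [|exact H].
  unfold tsum. apply epsilon_spec. eauto.
Qed.

Lemma HS_ext {X} (f g : X -> R) s : (forall x, f x = g x) -> HS f s -> HS g s.
Proof. intros H. replace g with f; [auto|]. now apply functional_extensionality. Qed.

Lemma tsum_ext {X} (f g : X -> R) : (forall x, f x = g x) -> tsum f = tsum g.
Proof. intros H. f_equal. now apply functional_extensionality. Qed.

Lemma HS_plus {X} (f g : X -> R) s s' :
  HS f s -> HS g s' -> HS (fun x => f x + g x) (s + s').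
Proof.
  intros H H' e He.
  destruct (H (e / 2)) as [l Hl]; [lra|]. destruct (H' (e / 2)) as [l' Hl']; [lra|].
  exists (l ++ l'). intros L HL Hi.
  specialize (Hl L HL (fun x Hx => Hi x (in_or_app _ _ _ (or_introl Hx)))).
  specialize (Hl' L HL (fun x Hx => Hi x (in_or_app _ _ _ (or_intror Hx)))).
  rewrite fsum_plus. apply Rabs_def2 in Hl. apply Rabs_def2 in Hl'. apply Rabs_def1; lra.
Qed.

Lemma HS_scal {X} c (f : X -> R) s : HS f s -> HS (fun x => c * f x) (c * s).
Proof.
  intros H e He.
  assert (Hc : 0 < Rabs c + 1) by (pose proof (Rabs_pos c); lra).
  destruct (H (e / (Rabs c + 1))) as [l Hl]; [apply Rdiv_lt_0_compat; lra|].
  exists l. intros L HL Hi. specialize (Hl L HL Hi).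
  rewrite fsum_scal, <- Rmult_minus_distr_l, Rabs_mult.
  apply (Rmult_lt_compat_l _ _ _ Hc) in Hl.
  replace ((Rabs c + 1) * (e / (Rabs c + 1))) with e in Hl by (field; lra).
  pose proof (Rabs_pos (fsum f L - s)). nra.
Qed.

Lemma HS_minus {X} (f g : X -> R) s s' :
  HS f s -> HS g s' -> HS (fun x => f x - g x) (s - s').
Proof.
  intros H H'. apply HS_ext with (fun x => f x + -1 * g x); [intros; lra|].
  replace (s - s') with (s + -1 * s') by lra. auto using HS_plus, HS_scal.
Qed.

Lemma HS_zero {X} : HS (fun _ : X => 0) 0.
Proof.
  intros e He. exists []. intros l _ _. rewrite fsum_zero, Rminus_0_r, Rabs_R0; auto.
Qed.

Lemma HS_fsum {X Y} (f : Y -> X -> R) (s : Y -> R) l :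
  (forall y, In y l -> HS (f y) (s y)) -> HS (fun x => fsum (fun y => f y x) l) (fsum s l).
Proof.
  induction l as [|y l IH]; intros H; simpl; [apply HS_zero|].
  apply HS_plus; auto with datatypes.
Qed.

Lemma HS_finite {X} (f : X -> R) K :
  NoDup K -> HS (fun x => indic (In x K) * f x) (fsum f K).
Proof.
  intros HK e He. exists K. intros l Hl Hi.
  replace (fsum _ l) with (fsum f K); [rewrite Rminus_diag, Rabs_R0; auto|].
  rewrite (fsum_ext f (fun x => fsum (fun y => indic (x = y) * f y) l)).
  2: intros; rewrite fsum_indic_eq; auto.
  rewrite fsum_swap. apply fsum_ext. intros y Hy.
  destruct (classic (In y K)) as [Hk|Hk].
  - rewrite indic_true by auto. rewrite <- (fsum_indic_eq (fun _ => 1 * f y) y K); auto.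
    apply fsum_ext. intros x _. rewrite Rmult_1_l. f_equal.
    destruct (classic (x = y)); [rewrite !indic_true|rewrite !indic_false]; auto.
  - rewrite indic_false, Rmult_0_l by auto. apply fsum_zero. intros x Hx.
    rewrite indic_false; [lra|congruence].
Qed.

Lemma HS_nonneg_ge {X} (f : X -> R) s l :
  (forall x, 0 <= f x) -> HS f s -> NoDup l -> fsum f l <= s.
Proof.
  intros Hf H Hl. apply Rnot_lt_le. intros Hlt.
  destruct (H (fsum f l - s)) as [l0 H0]; [lra|].
  specialize (H0 (undup (l0 ++ l)) (undup_NoDup _) (undup_incl _ _ (incl_appl _ (incl_refl _)))).
  pose proof (fsum_incl f l (undup (l0 ++ l)) Hf Hl (undup_incl _ _ (incl_appr _ (incl_refl _)))).
  apply Rabs_def2 in H0. lra.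
Qed.

Lemma HS_nonneg {X} (f : X -> R) s : (forall x, 0 <= f x) -> HS f s -> 0 <= s.
Proof. intros Hf H. exact (HS_nonneg_ge f s [] Hf H (NoDup_nil _)). Qed.

Lemma HS_le {X} (f g : X -> R) s s' :
  (forall x, f x <= g x) -> HS f s -> HS g s' -> s <= s'.
Proof.
  intros H Hf Hg. assert (0 <= s' - s); [|lra].
  apply (HS_nonneg (fun x => g x - f x)); [intros x; specialize (H x); lra|].
  now apply HS_minus.
Qed.

Lemma has_sum_nn_HS {X} (f : X -> R) s :
  (forall x, 0 <= f x) -> has_sum_nn f s <-> HS f s.
Proof.
  intros Hf. split.
  - intros [Hub Hlub] e He.
    destruct (classic (exists l, NoDup l /\ s - e < fsum f l)) as [(l & Hl & Hs)|Hn].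
    + exists l. intros L HL Hi. pose proof (fsum_incl f l L Hf Hl Hi).
      assert (fsum f L <= s) by (apply Hub; eauto). apply Rabs_def1; lra.
    + assert (s <= s - e); [|lra]. apply Hlub. intros r (l & Hl & ->).
      apply Rnot_lt_le. intros Hlt. apply Hn; eauto.
  - intros H. split.
    + intros r (l & Hl & ->). now apply HS_nonneg_ge.
    + intros b Hb. apply Rnot_lt_le. intros Hlt.
      destruct (H (s - b)) as [l Hl]; [lra|].
      specialize (Hl (undup l) (undup_NoDup _) (undup_incl _ _ (incl_refl _))).
      assert (fsum f (undup l) <= b) by (apply Hb; eauto using undup_NoDup).
      apply Rabs_def2 in Hl. lra.
Qed.

Lemma has_sum_HS {X} (f : X -> R) s : has_sum f s -> HS f s.
Proof.
  intros (sp & sn & Hp & Hn & ->).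
  apply has_sum_nn_HS in Hp; [|intros; apply Rmax_r].
  apply has_sum_nn_HS in Hn; [|intros; apply Rmax_r].
  apply HS_ext with (2 := HS_minus _ _ _ _ Hp Hn). intros x.
  unfold Rmax; repeat destruct Rle_dec; lra.
Qed.

Lemma HS_has_sum {X} (f : X -> R) s : (forall x, 0 <= f x) -> HS f s -> has_sum f s.
Proof.
  intros Hf H. exists s, 0. split; [|split; [|lra]]; apply has_sum_nn_HS; intros; try apply Rmax_r.
  - apply HS_ext with (2 := H). intros x. rewrite Rmax_left; auto.
  - apply HS_ext with (2 := HS_zero). intros x. rewrite Rmax_right; auto. specialize (Hf x); lra.
Qed.

Lemma summable_ext {X} (f g : X -> R) : (forall x, f x = g x) -> summable f -> summable g.
Proof. intros H. replace g with f; [auto|]. now apply functional_extensionality. Qed.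

Lemma summable_dom {X} (f g : X -> R) :
  (forall x, Rabs (f x) <= g x) -> summable g -> summable f.
Proof.
  intros H [M HM]. exists M. intros l Hl. eapply Rle_trans; [|apply (HM l Hl)].
  apply fsum_le. intros x _. eapply Rle_trans; [apply H|apply Rle_abs].
Qed.

Lemma HS_summable {X} (f : X -> R) s : (forall x, 0 <= f x) -> HS f s -> summable f.
Proof.
  intros Hf H. exists s. intros l Hl. rewrite (fsum_ext _ f).
  - now apply HS_nonneg_ge.
  - intros x _. now apply Rabs_pos_eq.
Qed.

Lemma summable_plus {X} (f g : X -> R) :
  summable f -> summable g -> summable (fun x => f x + g x).
Proof.
  intros [M HM] [M' HM']. exists (M + M'). intros l Hl.
  specialize (HM l Hl). specialize (HM' l Hl).
  eapply Rle_trans; [apply fsum_le; intros x _; apply Rabs_triang|].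
  rewrite (fsum_plus (fun x => Rabs (f x)) (fun x => Rabs (g x))). lra.
Qed.

Lemma summable_scal {X} c (f : X -> R) : summable f -> summable (fun x => c * f x).
Proof.
  intros [M HM]. exists (Rabs c * M). intros l Hl.
  rewrite (fsum_ext _ (fun x => Rabs c * Rabs (f x))) by (intros; apply Rabs_mult).
  rewrite fsum_scal. apply Rmult_le_compat_l; [apply Rabs_pos|auto].
Qed.

Lemma summable_abs {X} (f : X -> R) : summable f -> summable (fun x => Rabs (f x)).
Proof.
  intros [M HM]. exists M. intros l Hl. rewrite (fsum_ext _ (fun x => Rabs (f x))); auto.
  intros; apply Rabs_Rabsolu.
Qed.

(** For a nonnegative function the supremum of the finite sums is the sum. A signed [f] is the
    difference of the nonnegative functions [|f| + f] and [|f|]. *)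
Lemma summable_tsum {X} (f : X -> R) : summable f -> HS f (tsum f).
Proof.
  assert (Hnn : forall g : X -> R, (forall x, 0 <= g x) -> summable g -> exists s, HS g s).
  { intros g Hg [M HM].
    destruct (completeness (fun r => exists l, NoDup l /\ r = fsum g l)) as [s Hs].
    - exists M. intros r (l & Hl & ->). rewrite (fsum_ext _ (fun x => Rabs (g x))); auto.
      intros; symmetry; apply Rabs_pos_eq; auto.
    - exists 0, []. split; [constructor|reflexivity].
    - exists s. now apply has_sum_nn_HS. }
  intros H. unfold tsum. apply epsilon_spec.
  destruct (Hnn (fun x => Rabs (f x))) as [s Hs]; [intros; apply Rabs_pos|now apply summable_abs|].
  destruct (Hnn (fun x => Rabs (f x) + f x)) as [s' Hs'].
  - intros x. pose proof (Rabs_pos (f x)). unfold Rabs in *; destruct Rcase_abs; lra.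
  - auto using summable_plus, summable_abs.
  - exists (s' - s). apply HS_ext with (2 := HS_minus _ _ _ _ Hs' Hs). intros; lra.
Qed.

Lemma tsum_le {X} (f g : X -> R) :
  (forall x, f x <= g x) -> summable f -> summable g -> tsum f <= tsum g.
Proof. intros. eapply HS_le; eauto using summable_tsum. Qed.

Lemma tsum_plus {X} (f g : X -> R) :
  summable f -> summable g -> tsum (fun x => f x + g x) = tsum f + tsum g.
Proof. intros. apply HS_tsum, HS_plus; now apply summable_tsum. Qed.

Lemma tsum_scal {X} c (f : X -> R) :
  summable f -> tsum (fun x => c * f x) = c * tsum f.
Proof. intros. apply HS_tsum, HS_scal; now apply summable_tsum. Qed.

(** * Changes of variables, iterated sums, dominated convergence *)

Lemma HS_bij {X Y} (phi : X -> Y) (psi : Y -> X) (f : Y -> R) s :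
  (forall x, psi (phi x) = x) -> (forall y, phi (psi y) = y) ->
  HS f s -> HS (fun x => f (phi x)) s.
Proof.
  intros H1 H2 H e He. destruct (H e He) as [l0 H0]. exists (map psi l0).
  intros l Hl Hi. rewrite <- fsum_map. apply H0.
  - apply FinFun.Injective_map_NoDup; auto. intros x x' Hx. rewrite <- (H1 x), <- (H1 x'). congruence.
  - intros y Hy. rewrite <- (H2 y). apply in_map, Hi, in_map, Hy.
Qed.

Lemma summable_inj {X Y} (phi : X -> Y) (f : Y -> R) :
  (forall x x', phi x = phi x' -> x = x') -> summable f -> summable (fun x => f (phi x)).
Proof.
  intros Hi [M HM]. exists M. intros l Hl.
  rewrite <- (fsum_map (fun y => Rabs (f y)) phi). apply HM.
  now apply FinFun.Injective_map_NoDup.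
Qed.

Lemma NoDup_prod {X Y} (A : list X) (B : list Y) :
  NoDup A -> NoDup B -> NoDup (list_prod A B).
Proof.
  intros HA HB. induction HA as [|x A Hx HA IH]; simpl; [constructor|].
  apply NoDup_app; auto.
  - apply FinFun.Injective_map_NoDup; auto. intros y y' E; congruence.
  - intros [x' y] H H'. apply in_map_iff in H as (y' & E & _). apply in_prod_iff in H'.
    injection E as <- <-. tauto.
Qed.

(** Take finitely many rows [A] containing the projection of the set [l0] that witnesses convergence
    of the total. One finite set [B] of columns serves all these rows at once, and the rectangle
    over [A] and [B] contains [l0], so its sum is close both to the total and to the sum of [g] over
    [A]. *)
Lemma HS_fubini {X Y} (f : X * Y -> R) (g : X -> R) s :
  (forall x, HS (fun y => f (x, y)) (g x)) -> HS f s -> HS g s.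
Proof.
  intros Hr Hf e He. destruct (Hf (e / 2)) as [l0 H0]; [lra|].
  exists (map fst l0). intros A HA Hi.
  destruct (HS_fsum (fun x y => f (x, y)) g A (fun x _ => Hr x) (e / 2)) as [b0 Hb]; [lra|].
  set (B := undup (b0 ++ map snd l0)).
  specialize (Hb B (undup_NoDup _) (undup_incl _ _ (incl_appl _ (incl_refl _)))).
  specialize (H0 (list_prod A B) (NoDup_prod _ _ HA (undup_NoDup _))).
  rewrite fsum_list_prod, fsum_swap in H0.
  assert (Hi' : incl l0 (list_prod A B)).
  { intros [x y] Hxy. apply in_prod.
    - apply Hi. now apply (in_map fst) in Hxy.
    - apply (undup_incl _ _ (incl_appr _ (incl_refl _))). now apply (in_map snd) in Hxy. }
  specialize (H0 Hi'). apply Rabs_def2 in H0. apply Rabs_def2 in Hb. apply Rabs_def1; lra.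
Qed.

(** Every finite set of pairs lies in a rectangle, whose sum is bounded row by row. *)
Lemma summable_tonelli {X Y} (f : X * Y -> R) (g : X -> R) :
  (forall x, HS (fun y => Rabs (f (x, y))) (g x)) -> summable g -> summable f.
Proof.
  intros Hr [M HM]. exists M. intros l Hl.
  set (A := undup (map fst l)). set (B := undup (map snd l)).
  apply Rle_trans with (fsum (fun xy => Rabs (f xy)) (list_prod A B)).
  - apply fsum_incl; [intros; apply Rabs_pos|exact Hl|]. intros [x y] Hxy. apply in_prod; apply nodup_In.
    + now apply (in_map fst) in Hxy.
    + now apply (in_map snd) in Hxy.
  - rewrite fsum_list_prod. eapply Rle_trans; [|apply (HM A (undup_NoDup _))].
    apply fsum_le. intros x _. eapply Rle_trans; [|apply Rle_abs].
    apply HS_nonneg_ge; [intros; apply Rabs_pos|apply Hr|apply undup_NoDup].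
Qed.

Lemma HS_tonelli {X Y} (f : X * Y -> R) (g : X -> R) s :
  (forall xy, 0 <= f xy) -> (forall x, HS (fun y => f (x, y)) (g x)) -> HS g s -> HS f s.
Proof.
  intros Hf Hr Hg.
  assert (Hs : summable f).
  { apply (summable_tonelli f g).
    - intros x. apply HS_ext with (2 := Hr x). intros y. now rewrite Rabs_pos_eq.
    - apply HS_summable with s; auto. intros x. apply (HS_nonneg _ _ (fun y => Hf (x, y)) (Hr x)). }
  rewrite (HS_unique g s (tsum f)); auto using summable_tsum.
  apply HS_fubini with f; auto using summable_tsum.
Qed.

(** Both [g + f] and [g - f] are nonnegative, so their finite sums stay below [s' + s] and [s' - s].
    The tail of [g] thus controls that of [f]. *)
Lemma HS_tail {X} (f g : X -> R) s s' l :
  (forall x, Rabs (f x) <= g x) -> HS f s -> HS g s' -> NoDup l ->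
  Rabs (fsum f l - s) <= s' - fsum g l.
Proof.
  intros H Hf Hg Hl.
  assert (H1 : fsum (fun x => g x + f x) l <= s' + s).
  { apply HS_nonneg_ge; auto using HS_plus. intros x. specialize (H x).
    unfold Rabs in H; destruct Rcase_abs; lra. }
  assert (H2 : fsum (fun x => g x + -1 * f x) l <= s' + -1 * s).
  { apply HS_nonneg_ge; auto using HS_plus, HS_scal. intros x. specialize (H x).
    unfold Rabs in H; destruct Rcase_abs; lra. }
  rewrite fsum_plus in H1. rewrite fsum_plus, fsum_scal in H2. apply Rabs_le; lra.
Qed.

Lemma Un_cv_fsum {X} (f : nat -> X -> R) (g : X -> R) l :
  (forall x, Un_cv (fun n => f n x) (g x)) -> Un_cv (fun n => fsum (f n) l) (fsum g l).
Proof.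
  intros H. induction l as [|x l IH]; simpl.
  - intros e He. exists 0%nat. intros n _. unfold Rdist. rewrite Rminus_diag, Rabs_R0; auto.
  - apply CV_plus; auto.
Qed.

(** A finite set carries all but [e / 3] of the sum of [g]; convergence on it is termwise, and
    [HS_tail] bounds the remainder for [f n] and for [f0] alike. *)
Lemma tsum_dominated {X} (f : nat -> X -> R) (f0 g : X -> R) :
  (forall n x, Rabs (f n x) <= g x) -> summable g ->
  (forall x, Un_cv (fun n => f n x) (f0 x)) ->
  Un_cv (fun n => tsum (f n)) (tsum f0).
Proof.
  intros Hd Hg Hc e He.
  assert (H0 : forall x, Rabs (f0 x) <= g x).
  { intros x. apply (@Rle_cv_lim (fun n => Rabs (f n x)) (fun _ => g x)); auto.
    - apply cv_cvabs; auto.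
    - intros r Hr. exists 0%nat. intros n _. unfold Rdist. rewrite Rminus_diag, Rabs_R0; auto. }
  destruct (summable_tsum g Hg (e / 3)) as [l0 Hl]; [lra|].
  set (l := undup l0).
  specialize (Hl l (undup_NoDup _) (undup_incl _ _ (incl_refl _))). apply Rabs_def2 in Hl.
  destruct (Un_cv_fsum f f0 l Hc (e / 3)) as [n0 Hn]; [lra|].
  exists n0. intros n Hn'. specialize (Hn n Hn'). unfold Rdist in *.
  assert (T1 : Rabs (fsum (f n) l - tsum (f n)) <= tsum g - fsum g l).
  { apply HS_tail; [auto| |now apply summable_tsum|apply undup_NoDup].
    apply summable_tsum, summable_dom with g; auto. }
  assert (T2 : Rabs (fsum f0 l - tsum f0) <= tsum g - fsum g l).
  { apply HS_tail; [auto| |now apply summable_tsum|apply undup_NoDup].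
    apply summable_tsum, summable_dom with g; auto. }
  apply Rabs_le_inv in T1. apply Rabs_le_inv in T2. apply Rabs_def2 in Hn. apply Rabs_def1; lra.
Qed.

(** * Kantorovich duality *)

Definition linear {I : Type} (a : (I -> R) -> R) : Prop :=
  forall (c : R) u v, a (fun i => u i + c * v i) = a u + c * a v.

Lemma linear_zero {I} (a : (I -> R) -> R) : linear a -> a (fun _ => 0) = 0.
Proof.
  intros H. specialize (H (-1) (fun _ => 0) (fun _ => 0)). cbv beta in H.
  replace (fun i : I => 0 + -1 * 0) with (fun _ : I => 0) in H; [lra|].
  apply functional_extensionality; intros; lra.
Qed.

Lemma linear_scal {I} (a : (I -> R) -> R) c u : linear a -> a (fun i => c * u i) = c * a u.
Proof.
  intros H. rewrite <- (Rplus_0_l (c * a u)), <- (linear_zero a H), <- H. f_equal.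
  apply functional_extensionality; intros; lra.
Qed.

(* Bartl's proof of Farkas' lemma: a vector [z] violating the implication for the shorter
   list of constraints is used to project along [z] onto the kernel of the new constraint. *)
Lemma farkas {I J} (l : list J) : NoDup l ->
  forall (A : J -> (I -> R) -> R) (b : (I -> R) -> R),
  (forall j, linear (A j)) -> linear b ->
  (forall y, (forall j, In j l -> A j y <= 0) -> b y <= 0) ->
  exists m : J -> R, (forall j, 0 <= m j) /\ forall y, b y = fsum (fun j => m j * A j y) l.
Proof.
  intros Hl. induction Hl as [|k l Hk Hl IH]; intros A b HA Hb H.
  - exists (fun _ => 0). split; [intros; lra|]. intros y. simpl.
    assert (b y <= 0) by (apply H; intros j []).
    assert (b (fun i => -1 * y i) <= 0) by (apply H; intros j []).
    rewrite linear_scal in H1 by auto. lra.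
  - destruct (classic (forall y, (forall j, In j l -> A j y <= 0) -> b y <= 0)) as [H0|H0].
    + destruct (IH A b HA Hb H0) as (m & Hm & Hs).
      exists (fun j => if eq_dec_cl j k then 0 else m j). split.
      * intros j. destruct eq_dec_cl; auto; lra.
      * intros y. simpl. destruct (eq_dec_cl k k); [|congruence]. rewrite Hs.
        rewrite Rmult_0_l, Rplus_0_l. apply fsum_ext. intros j Hj.
        destruct eq_dec_cl; [congruence|auto].
    + apply not_all_ex_not in H0 as [z Hz]. apply imply_to_and in Hz as [Hz Hbz].
      assert (Hkz : 0 < A k z).
      { apply Rnot_le_lt. intros Hle. apply Hbz, H. intros j [<-|Hj]; auto. }
      destruct (IH (fun j y => A j y - A j z / A k z * A k y)
                   (fun y => b y - b z / A k z * A k y)) as (m & Hm & Hs).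
      * intros j c u v. rewrite !HA. ring.
      * intros c u v. rewrite HA, Hb. ring.
      * intros y Hy.
        assert (E : forall a, linear a ->
          a (fun i => y i + - (A k y / A k z) * z i) = a y - a z / A k z * A k y).
        { intros a Ha. rewrite Ha. field. lra. }
        rewrite <- E by auto. apply H. intros j [<-|Hj]; rewrite E by auto; auto.
        right. field. lra.
      (* Expanding the projected identity gives [A k y] this coefficient. It is nonnegative because
         [b z] and [A k z] are positive, while [A i z <= 0] for the constraints in [l]. *)
      * exists (fun j => if eq_dec_cl j k
                  then b z / A k z - fsum (fun i => m i * (A i z / A k z)) l else m j).
        split.
        -- intros j. destruct eq_dec_cl; auto.
           assert (0 <= b z / A k z) by (apply Rlt_le, Rdiv_lt_0_compat; lra).
           assert (fsum (fun i => m i * (A i z / A k z)) l <= 0); [|lra].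
           rewrite <- (fsum_zero (fun _ : J => 0) l) by auto. apply fsum_le. intros i Hi.
           assert (A i z / A k z <= 0).
           { unfold Rdiv. specialize (Hz i Hi).
             assert (0 < / A k z) by now apply Rinv_0_lt_compat. nra. }
           specialize (Hm i). nra.
        -- intros y. specialize (Hs y). simpl. destruct (eq_dec_cl k k); [|congruence].
           set (t := b z / A k z - _).
           rewrite (fsum_ext _ (fun j => m j * A j y) l).
           2: { intros j Hj. destruct eq_dec_cl; [congruence|auto]. }
           rewrite (fsum_ext _ (fun j => m j * A j y + - A k y * (m j * (A j z / A k z))) l) in Hs
             by (intros; ring).
           rewrite fsum_plus, fsum_scal in Hs. unfold t. lra.
Qed.

(** Linear programming duality. The unknown vector of [farkas] is indexed by [option (X + X)]: two
    families of coordinates are the potentials [phi] and [psi], and [None] is a scale [s >= 0] for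
    the cost, which makes the constraints homogeneous. The multipliers of the constraints indexed by
    pairs form the transport plan. *)
Lemma transport_finite {X} (d : X -> X -> R) (K : list X) (a b : X -> R) (w : R) :
  NoDup K ->
  (forall (phi psi : X -> R) s, 0 <= s ->
     (forall x y, In x K -> In y K -> phi x + psi y <= s * d x y) ->
     fsum (fun x => a x * phi x) K + fsum (fun y => b y * psi y) K <= s * w) ->
  exists p : X * X -> R, (forall xy, 0 <= p xy) /\
    (forall x, In x K -> fsum (fun y => p (x, y)) K = a x) /\
    (forall y, In y K -> fsum (fun x => p (x, y)) K = b y) /\
    fsum (fun xy => p xy * d (fst xy) (snd xy)) (list_prod K K) <= w.
Proof.
  intros HK H.
  set (A := fun (j : option (X * X)) (y : option (X + X) -> R) =>
    match j with
    | None => - y None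
    | Some (x, x') => y (Some (inl x)) + y (Some (inr x')) - y None * d x x'
    end).
  set (B := fun y : option (X + X) -> R =>
    fsum (fun x => a x * y (Some (inl x))) K + fsum (fun x => b x * y (Some (inr x))) K
    - y None * w).
  destruct (@farkas (option (X + X)) _ (None :: map Some (list_prod K K))) with (A := A) (b := B)
    as (m & Hm & Hs).
  - constructor.
    + intros Hin. apply in_map_iff in Hin as (? & ? & _). discriminate.
    + apply Injective_map_NoDup; [intros ? ?; congruence|now apply NoDup_prod].
  - intros [[x x']|] c u v; unfold A; ring.
  - intros c u v. unfold B.
    rewrite (fsum_ext (fun x => a x * (u (Some (inl x)) + c * v (Some (inl x))))
      (fun x => a x * u (Some (inl x)) + c * (a x * v (Some (inl x))))) by (intros; ring).
    rewrite (fsum_ext (fun x => b x * (u (Some (inr x)) + c * v (Some (inr x))))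
      (fun x => b x * u (Some (inr x)) + c * (b x * v (Some (inr x))))) by (intros; ring).
    rewrite !fsum_plus, !fsum_scal. ring.
  - intros y Hy.
    pose proof (Hy None (or_introl eq_refl)) as H0. simpl in H0.
    specialize (H (fun x => y (Some (inl x))) (fun x => y (Some (inr x))) (y None)).
    unfold B. cut (fsum (fun x => a x * y (Some (inl x))) K
      + fsum (fun x => b x * y (Some (inr x))) K <= y None * w); [lra|].
    apply H; [lra|]. intros x x' Hx Hx'.
    pose proof (Hy (Some (x, x')) (or_intror (in_map _ _ _ (in_prod _ _ _ _ Hx Hx')))) as H1.
    simpl in H1. lra.
  - assert (Hs' : forall y, B y = m None * A None y
        + fsum (fun x => fsum (fun x' => m (Some (x, x')) * A (Some (x, x')) y) K) K).
    { intros y. rewrite Hs. simpl. rewrite fsum_map, fsum_list_prod. reflexivity. }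
    clear Hs. exists (fun xy => m (Some xy)). split; [auto|]. split; [|split].
    (* Testing the identity on a unit vector of the first potential reads off one row sum; the
       second potential gives the column sums in the same way. *)
    + intros x Hx.
      specialize (Hs' (fun i => match i with Some (inl z) => indic (x = z) | _ => 0 end)).
      unfold A, B in Hs'.
      rewrite (fsum_ext _ (fun z => indic (x = z) * a z)) in Hs' by (intros; ring).
      rewrite fsum_indic_eq, (fsum_zero (fun z => b z * 0)) in Hs' by (auto; intros; ring).
      rewrite (fsum_ext _ (fun z => indic (x = z) * fsum (fun x' => m (Some (z, x'))) K)) in Hs'.
      2: { intros z _. rewrite <- fsum_scal. apply fsum_ext. intros; ring. }
      rewrite fsum_indic_eq in Hs' by auto. lra.
    + intros x Hx.
      specialize (Hs' (fun i => match i with Some (inr z) => indic (x = z) | _ => 0 end)).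
      unfold A, B in Hs'. rewrite fsum_swap in Hs'.
      rewrite (fsum_ext (fun z => b z * _) (fun z => indic (x = z) * b z)) in Hs' by (intros; ring).
      rewrite (fsum_zero (fun z => a z * 0)) in Hs' by (auto; intros; ring).
      rewrite fsum_indic_eq in Hs' by auto.
      rewrite (fsum_ext _ (fun z => indic (x = z) * fsum (fun x' => m (Some (x', z))) K)) in Hs'.
      2: { intros z _. rewrite <- fsum_scal. apply fsum_ext. intros; ring. }
      rewrite fsum_indic_eq in Hs' by auto. lra.
    (* At scale [-1] and zero potentials [B] equals [w], and the constraint [None] contributes its
       multiplier [m None >= 0], the slack in the cost bound. *)
    + specialize (Hs' (fun i => match i with None => -1 | _ => 0 end)).
      unfold A, B in Hs'. rewrite !(fsum_zero (fun z => _ * 0)) in Hs' by (intros; ring).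
      rewrite fsum_list_prod.
      rewrite (fsum_ext _ (fun x => fsum (fun y => m (Some (x, y)) * d x y) K)) in Hs'.
      2: { intros z _. apply fsum_ext. intros; ring. }
      simpl. specialize (Hm None). lra.
Qed.

Lemma list_min {X Y} (h : Y -> X -> R) (K : list Y) : K <> [] ->
  exists F, forall x, (exists k, In k K /\ F x = h k x) /\ forall k, In k K -> F x <= h k x.
Proof.
  induction K as [|k K IH]; [congruence|]. intros _.
  destruct (classic (K = [])) as [->|HK].
  - exists (h k). intros x. split; [exists k; simpl; auto|]. intros k' [<-|[]]. lra.
  - destruct (IH HK) as [F HF]. exists (fun x => Rmin (h k x) (F x)). intros x.
    destruct (HF x) as [(k' & Hk' & E) Hle]. split.
    + apply Rmin_case; [exists k|exists k']; simpl; auto.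
    + intros k'' [<-|Hk'']; [apply Rmin_l|].
      eapply Rle_trans; [apply Rmin_r|auto].
Qed.

Section Kantorovich.
Context {X : Type} (d : X -> X -> R) (o : X).
Hypothesis d_nonneg : forall x y, 0 <= d x y.
Hypothesis d_refl : forall x, d x x = 0.
Hypothesis d_sym : forall x y, d x y = d y x.
Hypothesis d_tri : forall x y z, d x z <= d x y + d y z.

Definition lipschitz (L : R) (F : X -> R) : Prop := forall x y, F x - F y <= L * d x y.

Lemma lipschitz_Rabs L F x y : lipschitz L F -> Rabs (F x - F y) <= L * d x y.
Proof.
  intros H. pose proof (H x y). pose proof (H y x). rewrite d_sym in H1.
  apply Rabs_le. lra.
Qed.

(** * Collapsing to finitely many points *)

Definition trunc (K : list X) (x : X) : X := if excluded_middle_informative (In x K) then x else o.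

Definition push (K : list X) (Q : X -> R) (k : X) : R := tsum (fun x => Q x * indic (trunc K x = k)).

Lemma trunc_In K x : In o K -> In (trunc K x) K.
Proof. unfold trunc. destruct excluded_middle_informative; auto. Qed.

(** Points of [K] do not move, so the cost of the collapse is the tail of the first moment. *)
Lemma HS_trunc_dist K Q m : NoDup K -> HS (fun x => Q x * d x o) m ->
  HS (fun x => Q x * d x (trunc K x)) (m - fsum (fun x => Q x * d x o) K).
Proof.
  intros HK H. apply HS_ext with (2 := HS_minus _ _ _ _ H (HS_finite _ _ HK)).
  intros x. unfold trunc, indic. destruct excluded_middle_informative; [rewrite d_refl|]; lra.
Qed.

Lemma summable_push K Q k : summable Q -> summable (fun x => Q x * indic (trunc K x = k)).
Proof.
  intros H. apply summable_dom with (fun x => Rabs (Q x)); [|now apply summable_abs].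
  intros x. rewrite Rabs_mult. unfold indic.
  destruct excluded_middle_informative; rewrite ?Rabs_R1, ?Rabs_R0; pose proof (Rabs_pos (Q x)); lra.
Qed.

Lemma HS_push K Q (G : X -> R) : NoDup K -> In o K -> summable Q ->
  HS (fun x => Q x * G (trunc K x)) (fsum (fun k => push K Q k * G k) K).
Proof.
  intros HK Ho HQ.
  apply HS_ext with (fun x => fsum (fun k => Q x * indic (trunc K x = k) * G k) K).
  - intros x. rewrite (fsum_ext _ (fun k => indic (trunc K x = k) * (Q x * G k))) by (intros; ring).
    now rewrite fsum_indic_eq by auto using trunc_In.
  - apply HS_fsum. intros k _. rewrite Rmult_comm.
    apply HS_ext with (fun x => G k * (Q x * indic (trunc K x = k))); [intros; ring|].
    apply HS_scal, summable_tsum, summable_push, HQ.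
Qed.

(** A fibre of mass zero contains only points of weight zero; this keeps the quotients
    [Q x / push K Q (trunc K x)] correct where the denominator vanishes. *)
Lemma push_ge K Q x : (forall x, 0 <= Q x) -> summable Q -> Q x <= push K Q (trunc K x).
Proof.
  intros H HQ.
  replace (Q x) with (fsum (fun y => Q y * indic (trunc K y = trunc K x)) [x]).
  - apply HS_nonneg_ge.
    + intros y. unfold indic. specialize (H y). destruct excluded_middle_informative; lra.
    + now apply summable_tsum, summable_push.
    + repeat constructor. simpl. tauto.
  - simpl. rewrite indic_true by auto. ring.
Qed.

(** The mass [p k] is spread over the fibre of [k] in proportion to [Q]. On a fibre of mass zero the
    bound on [p] forces [p k = 0]. *)
Lemma HS_lift K (Q : X -> R) (p : X -> R) : NoDup K -> In o K ->
  (forall x, 0 <= Q x) -> summable Q ->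
  (forall k, In k K -> 0 <= p k <= push K Q k) ->
  HS (fun y => Q y / push K Q (trunc K y) * p (trunc K y)) (fsum p K).
Proof.
  intros HK Ho HQ HQs Hp.
  rewrite (fsum_ext p (fun k => push K Q k * (/ push K Q k * p k))).
  - apply HS_ext with (2 := HS_push K Q (fun k => / push K Q k * p k) HK Ho HQs).
    intros; unfold Rdiv; ring.
  - intros k Hk. destruct (Req_dec (push K Q k) 0) as [E|E]; [|field; auto].
    specialize (Hp k Hk). rewrite E in *. lra.
Qed.

(** Mass goes from [x] to its collapsed point, then along a finite plan, then out to [y]. The outer
    legs cost less than [eps / 4] each; the finite duality is run with [w + eps / 2], since
    collapsing changes the dual values by at most the cost of the two legs. *)
Lemma kantorovich (Q P : X -> R) (mQ mP w : R) :
  (forall x, 0 <= Q x) -> (forall x, 0 <= P x) -> HS Q 1 -> HS P 1 ->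
  HS (fun x => Q x * d x o) mQ -> HS (fun x => P x * d x o) mP ->
  (forall F, lipschitz 1 F -> tsum (fun x => Q x * F x) - tsum (fun x => P x * F x) <= w) ->
  forall eps, 0 < eps ->
  exists p v, (forall xy, 0 <= p xy) /\
    (forall x, HS (fun y => p (x, y)) (Q x)) /\
    (forall y, HS (fun x => p (x, y)) (P y)) /\
    HS (fun xy => p xy * d (fst xy) (snd xy)) v /\ v <= w + eps.
Proof.
  intros HQ HP HQ1 HP1 HmQ HmP Hw eps Heps.
  assert (HQs : summable Q) by (eapply HS_summable; eauto).
  assert (HPs : summable P) by (eapply HS_summable; eauto).
  destruct (HmQ (eps / 4)) as [l1 Hl1]; [lra|].
  destruct (HmP (eps / 4)) as [l2 Hl2]; [lra|].
  set (K := undup (o :: l1 ++ l2)).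
  assert (HK : NoDup K) by apply undup_NoDup.
  assert (Ho : In o K) by (apply nodup_In; simpl; auto).
  assert (Hi1 : incl l1 K).
  { intros x Hx. apply nodup_In. right. apply in_or_app. auto. }
  assert (Hi2 : incl l2 K).
  { intros x Hx. apply nodup_In. right. apply in_or_app. auto. }
  specialize (Hl1 K HK Hi1). specialize (Hl2 K HK Hi2).
  apply Rabs_def2 in Hl1. apply Rabs_def2 in Hl2.
  pose proof (HS_trunc_dist K Q mQ HK HmQ) as HdQ.
  pose proof (HS_trunc_dist K P mP HK HmP) as HdP.
  set (eQ := mQ - fsum (fun x => Q x * d x o) K) in *.
  set (eP := mP - fsum (fun x => P x * d x o) K) in *.
  clearbody K. clear Hi1 Hi2.
  (* The collapse changes the integral of a 1-Lipschitz function by at most the cost of moving the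
     mass. *)
  assert (Hint : forall (R0 : X -> R) m F e, (forall x, 0 <= R0 x) -> HS R0 1 ->
    HS (fun x => R0 x * d x o) m -> lipschitz 1 F ->
    HS (fun x => R0 x * d x (trunc K x)) e ->
    Rabs (tsum (fun x => R0 x * F x) - fsum (fun k => push K R0 k * F k) K) <= e).
  { intros R0 m F e HR HR1 HRm HF He.
    assert (HRs : summable R0) by (eapply HS_summable; eauto).
    assert (HS1 : HS (fun x => R0 x * F x) (tsum (fun x => R0 x * F x))).
    { apply summable_tsum, summable_dom with (fun x => Rabs (F o) * R0 x + R0 x * d x o).
      - intros x. rewrite Rabs_mult, (Rabs_pos_eq (R0 x)) by auto.
        pose proof (lipschitz_Rabs 1 F x o HF).
        pose proof (Rabs_triang (F o) (F x - F o)).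
        replace (F o + (F x - F o)) with (F x) in H0 by ring. specialize (HR x). nra.
      - apply summable_plus; [now apply summable_scal|]. eapply HS_summable; eauto.
        intros; apply Rmult_le_pos; auto. }
    pose proof (HS_push K R0 F HK Ho HRs) as HS2.
    pose proof (HS_minus _ _ _ _ HS1 HS2) as HS3.
    assert (Hb : forall x, Rabs (R0 x * F x - R0 x * F (trunc K x)) <= R0 x * d x (trunc K x)).
    { intros x. rewrite <- Rmult_minus_distr_l, Rabs_mult, Rabs_pos_eq by auto.
      apply Rmult_le_compat_l; auto. rewrite <- (Rmult_1_l (d _ _)). now apply lipschitz_Rabs. }
    apply Rabs_le. split.
    - apply HS_le with (2 := HS_scal (-1) _ _ He) (g := fun x => R0 x * F x - R0 x * F (trunc K x)) in HS3.
      + lra.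
      + intros x. specialize (Hb x). apply Rabs_le_inv in Hb. lra.
    - apply HS_le with (3 := He) (f := fun x => R0 x * F x - R0 x * F (trunc K x)) in HS3; [lra|].
      intros x. specialize (Hb x). apply Rabs_le_inv in Hb. lra. }
  destruct (transport_finite d K (push K Q) (push K P) (w + eps / 2) HK) as (q & Hq & Hrow & Hcol & Hcost).
  { intros phi psi s Hs Hle.
    (* This [F] is the transform of [psi] relative to the cost: an [s]-Lipschitz function with
       [phi <= F <= - psi] on [K], so that a single function replaces the pair of potentials. *)
    destruct (list_min (fun k x => s * d x k - psi k) K) as [F HF].
    { intros E. rewrite E in Ho. destruct Ho. }
    assert (HLF : lipschitz s F).
    { intros x y. destruct (HF y) as [(k & Hk & ->) _]. destruct (HF x) as [_ Hx].
      specialize (Hx k Hk). pose proof (d_tri x y k). nra. }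
    assert (push_nonneg : forall (R0 : X -> R) k, (forall x, 0 <= R0 x) -> summable R0 -> 0 <= push K R0 k).
    { intros R0 k HR HRs. apply (HS_nonneg (fun x => R0 x * indic (trunc K x = k))).
      - intros x. unfold indic. specialize (HR x). destruct excluded_middle_informative; lra.
      - now apply summable_tsum, summable_push. }
    assert (H1 : fsum (fun x => push K Q x * phi x) K <= fsum (fun x => push K Q x * F x) K).
    { apply fsum_le. intros x Hx. apply Rmult_le_compat_l; auto.
      destruct (HF x) as [(k & Hk & ->) _]. specialize (Hle x k Hx Hk). lra. }
    assert (H2 : fsum (fun x => push K P x * psi x) K <= -1 * fsum (fun x => push K P x * F x) K).
    { rewrite <- fsum_scal. apply fsum_le. intros x Hx.
      destruct (HF x) as [_ HF']. specialize (HF' x Hx). rewrite d_refl in HF'.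
      specialize (push_nonneg P x HP HPs). nra. }
    cut (fsum (fun x => push K Q x * F x) K - fsum (fun x => push K P x * F x) K <= s * (w + eps / 2));
      [lra|].
    destruct Hs as [Hs|<-].
    - assert (HL1 : lipschitz 1 (fun x => / s * F x)).
      { intros x y. specialize (HLF x y).
        apply (Rmult_le_compat_l (/ s)) in HLF; [|apply Rlt_le, Rinv_0_lt_compat; auto].
        replace (/ s * (s * d x y)) with (1 * d x y) in HLF by (field; lra). lra. }
      specialize (Hw _ HL1).
      pose proof (Hint Q mQ _ eQ HQ HQ1 HmQ HL1 HdQ) as G1.
      pose proof (Hint P mP _ eP HP HP1 HmP HL1 HdP) as G2.
      apply Rabs_le_inv in G1. apply Rabs_le_inv in G2.
      rewrite (fsum_ext _ (fun k => / s * (push K Q k * F k)) K), fsum_scal in G1 by (intros; ring).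
      rewrite (fsum_ext _ (fun k => / s * (push K P k * F k)) K), fsum_scal in G2 by (intros; ring).
      set (u := fsum (fun x => push K Q x * F x) K) in *.
      set (v := fsum (fun x => push K P x * F x) K) in *.
      replace (u - v) with (s * (/ s * u - / s * v)) by (field; lra).
      apply Rmult_le_compat_l; unfold eQ, eP in *; lra.
    (* For [s = 0] the function [F] is constant, and both collapsed laws have total mass 1. *)
    - assert (HF0 : forall (R0 : X -> R), HS R0 1 -> summable R0 ->
        fsum (fun x => push K R0 x * F x) K = F o).
      { intros R0 HR HRs. apply (HS_unique (fun x => R0 x * F (trunc K x))).
        - now apply HS_push.
        - apply HS_ext with (fun x => F o * R0 x).
          + intros x. pose proof (HLF o (trunc K x)). pose proof (HLF (trunc K x) o).
            replace (F (trunc K x)) with (F o) by lra. ring.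
          + pose proof (HS_scal (F o) _ _ HR) as H3. rewrite Rmult_1_r in H3. exact H3. }
      rewrite !HF0 by auto. lra. }
  assert (Hq1 : forall k k', In k K -> In k' K -> 0 <= q (k, k') <= push K Q k).
  { intros k k' Hk Hk'. split; auto. rewrite <- Hrow by auto.
    replace (q (k, k')) with (fsum (fun y => q (k, y)) [k']) by (simpl; ring).
    apply fsum_incl; auto; [repeat constructor; simpl; tauto|]. intros z [<-|[]]; auto. }
  assert (Hq2 : forall k k', In k K -> In k' K -> 0 <= q (k, k') <= push K P k').
  { intros k k' Hk Hk'. split; auto. rewrite <- Hcol by auto.
    replace (q (k, k')) with (fsum (fun y => q (y, k')) [k]) by (simpl; ring).
    apply fsum_incl; auto; [repeat constructor; simpl; tauto|]. intros z [<-|[]]; auto. }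
  set (T := trunc K).
  set (rQ := fun x => Q x / push K Q (T x)). set (rP := fun x => P x / push K P (T x)).
  assert (ratio : forall (R0 : X -> R) x, (forall x, 0 <= R0 x) -> summable R0 ->
    0 <= R0 x / push K R0 (T x) /\ R0 x / push K R0 (T x) * push K R0 (T x) = R0 x).
  { intros R0 x HR HRs. pose proof (push_ge K R0 x HR HRs). pose proof (HR x). fold T in H.
    destruct (Req_dec (push K R0 (T x)) 0) as [E|E].
    - replace (R0 x) with 0 by lra. unfold Rdiv. rewrite Rmult_0_l. lra.
    - split; [apply Rle_mult_inv_pos; lra|field; auto]. }
  (* Given the collapsed pair, drawn from [q], the two points are independent in their fibres, with
     laws proportional to [Q] and [P]. *)
  set (p := fun xy : X * X => rQ (fst xy) * rP (snd xy) * q (T (fst xy), T (snd xy))).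
  assert (HrQ : forall x, 0 <= rQ x) by (intros x; now apply (ratio Q x)).
  assert (HrP : forall x, 0 <= rP x) by (intros x; now apply (ratio P x)).
  assert (Hp : forall xy, 0 <= p xy).
  { intros xy. unfold p. apply Rmult_le_pos; [apply Rmult_le_pos|]; auto. }
  assert (Hprow : forall x, HS (fun y => p (x, y)) (Q x)).
  { intros x. pose proof (trunc_In K x Ho) as HTx.
    apply HS_ext with (fun y => rQ x * (rP y * q (T x, T y))); [intros; unfold p; simpl; ring|].
    replace (Q x) with (rQ x * fsum (fun k => q (T x, k)) K).
    - apply HS_scal. unfold rP, T. apply (HS_lift K P (fun k => q (trunc K x, k))); auto.
    - unfold T. rewrite Hrow by auto. now apply (ratio Q x). }
  assert (Hpcol : forall y, HS (fun x => p (x, y)) (P y)).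
  { intros y. pose proof (trunc_In K y Ho) as HTy.
    apply HS_ext with (fun x => rP y * (rQ x * q (T x, T y))); [intros; unfold p; simpl; ring|].
    replace (P y) with (rP y * fsum (fun k => q (k, T y)) K).
    - apply HS_scal. unfold rQ, T. apply (HS_lift K Q (fun k => q (k, trunc K y))); auto.
    - unfold T. rewrite Hcol by auto. now apply (ratio P y). }
  assert (C1 : HS (fun xy => p xy * d (fst xy) (T (fst xy))) eQ).
  { apply HS_tonelli with (fun x => Q x * d x (T x)); auto.
    - intros; apply Rmult_le_pos; auto.
    - intros x. simpl. rewrite Rmult_comm.
      apply HS_ext with (fun y => d x (T x) * p (x, y)); [intros; ring|]. now apply HS_scal. }
  assert (C2 : HS (fun xy => p xy * d (snd xy) (T (snd xy))) eP).
  { apply HS_bij with (phi := fun xy : X * X => (snd xy, fst xy))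
      (psi := fun xy => (snd xy, fst xy)) (f := fun yx => p (snd yx, fst yx) * d (fst yx) (T (fst yx))).
    1,2: now intros [].
    apply HS_tonelli with (fun x => P x * d x (T x)); auto.
    - intros; apply Rmult_le_pos; auto.
    - intros y. simpl. rewrite Rmult_comm.
      apply HS_ext with (fun x => d y (T y) * p (x, y)); [intros; ring|]. now apply HS_scal. }
  assert (C3 : HS (fun xy => p xy * d (T (fst xy)) (T (snd xy)))
                  (fsum (fun k => fsum (fun k' => q (k, k') * d k k') K) K)).
  { apply HS_tonelli with (fun x => rQ x * fsum (fun k' => q (T x, k') * d (T x) k') K).
    - intros; apply Rmult_le_pos; auto.
    - intros x. simpl. pose proof (trunc_In K x Ho) as HTx.
      apply HS_ext with (fun y => rQ x * (P y * (/ push K P (T y) * (q (T x, T y) * d (T x) (T y))))).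
      { intros y. unfold p, rP, Rdiv; simpl; ring. }
      apply HS_scal.
      rewrite (fsum_ext _ (fun k => push K P k * (/ push K P k * (q (T x, k) * d (T x) k)))).
      + apply (HS_push K P (fun k => / push K P k * (q (T x, k) * d (T x) k))); auto.
      + intros k Hk. destruct (Req_dec (push K P k) 0) as [E|E]; [|field; auto].
        pose proof (Hq2 (T x) k HTx Hk). replace (q (T x, k)) with 0 by lra. ring.
    - rewrite (fsum_ext _ (fun k => push K Q k * (/ push K Q k * fsum (fun k' => q (k, k') * d k k') K))).
      + apply HS_ext with (2 := HS_push K Q _ HK Ho HQs). intros; unfold rQ, T, Rdiv; ring.
      + intros k Hk. destruct (Req_dec (push K Q k) 0) as [E|E]; [|field; auto].
        rewrite fsum_zero; [ring|]. intros k' Hk'. pose proof (Hq1 k k' Hk Hk').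
        replace (q (k, k')) with 0 by lra. ring. }
  rewrite fsum_list_prod in Hcost. simpl in Hcost.
  pose proof (HS_plus _ _ _ _ (HS_plus _ _ _ _ C1 C2) C3) as C4. simpl in C4.
  assert (Hle : forall xy, p xy * d (fst xy) (snd xy) <=
    p xy * d (fst xy) (T (fst xy)) + p xy * d (snd xy) (T (snd xy)) + p xy * d (T (fst xy)) (T (snd xy))).
  { intros [x y]. simpl. pose proof (d_tri x (T x) y). pose proof (d_tri (T x) (T y) y).
    rewrite (d_sym (T y) y) in H0. specialize (Hp (x, y)). nra. }
  assert (Hsum : summable (fun xy => p xy * d (fst xy) (snd xy))).
  { eapply summable_dom; [|eapply HS_summable with (2 := C4)].
    - intros xy. rewrite Rabs_pos_eq by (apply Rmult_le_pos; auto). apply Hle.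
    - intros xy. eapply Rle_trans; [|apply Hle]. apply Rmult_le_pos; auto. }
  exists p, (tsum (fun xy => p xy * d (fst xy) (snd xy))).
  repeat split; auto using summable_tsum.
  eapply Rle_trans; [eapply HS_le; [apply Hle|apply summable_tsum, Hsum|apply C4]|].
  unfold eQ, eP. lra.
Qed.

End Kantorovich.

(** * Scalar inequalities *)

Lemma exp_le x y : x <= y -> exp x <= exp y.
Proof. intros [H| ->]; [left; now apply exp_increasing|lra]. Qed.

Lemma derive_nonneg_incr (f f' : R -> R) x :
  0 <= x -> (forall c, 0 <= c -> is_derive f c (f' c)) -> (forall c, 0 <= c -> 0 <= f' c) ->
  f 0 <= f x.
Proof.
  intros [Hx|<-] Hd Hp; [|lra].
  destruct (MVT_cor2 f f' 0 x Hx) as (c & E & Hc).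
  - intros c Hc. apply is_derive_Reals, Hd. lra.
  - specialize (Hp c). nra.
Qed.

Definition hstar (t : R) : R := exp t - 1 - t.

Lemma hstar_nonneg t : 0 <= hstar t.
Proof. unfold hstar. pose proof (exp_ineq1_le t). lra. Qed.

Lemma hstar_0 : hstar 0 = 0.
Proof. unfold hstar. rewrite exp_0. ring. Qed.

(** The derivative of the difference is [hstar] itself. *)
Lemma hstar_quadratic t : 0 <= t -> t ^ 2 / 2 <= hstar t.
Proof.
  intros Ht. set (f := fun t => hstar t - t ^ 2 / 2).
  assert (H : f 0 <= f t); [|unfold f in H; rewrite hstar_0 in H; lra].
  apply (derive_nonneg_incr f hstar); auto.
  - intros c _. unfold f, hstar. auto_derive; [auto|]. field.
  - intros c _. apply hstar_nonneg.
Qed.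

(** Increments of a Lipschitz function have either sign. On the positive side [hstar] increases, and
    [hstar (- y) <= hstar y] for [0 <= y] amounts to [y <= sinh y]. *)
Lemma hstar_Rabs s t : Rabs s <= t -> hstar s <= hstar t.
Proof.
  assert (Hmono : forall a b, 0 <= a -> a <= b -> hstar a <= hstar b).
  { intros a b Ha Hab. unfold hstar. replace b with (a + (b - a)) at 1 by ring.
    rewrite exp_plus. pose proof (exp_ineq1_le (b - a)). pose proof (exp_ineq1_le a). nra. }
  assert (Hneg : forall y, 0 <= y -> hstar (- y) <= hstar y).
  { intros y Hy.
    set (f := fun y => hstar y - hstar (- y)).
    assert (H : f 0 <= f y); [|unfold f in H; rewrite Ropp_0, hstar_0 in H; lra].
    apply (derive_nonneg_incr f (fun y => exp y + exp (- y) - 2)); auto.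
    - intros c _. unfold f, hstar. auto_derive; [auto|]. ring.
    - intros c _. pose proof (exp_ineq1_le c). pose proof (exp_ineq1_le (- c)). lra. }
  intros H. unfold Rabs in H. destruct Rcase_abs.
  - apply Rle_trans with (hstar (- s)); [|apply Hmono; lra].
    rewrite <- (Ropp_involutive s) at 1. apply Hneg. lra.
  - apply Hmono; lra.
Qed.

(** The function [psi] vanishes with its first derivative at 0. With
    [theta = p e^u / (1 - p + p e^u)] its second derivative is [1 / 4 - theta (1 - theta)], a
    square. *)
Lemma hoeffding_scalar p u : 0 <= p <= 1 -> 0 <= u ->
  1 - p + p * exp u <= exp (p * u + u ^ 2 / 8).
Proof.
  intros Hp Hu.
  assert (Hpos : forall c, 0 <= c -> 0 < 1 - p + p * exp c).
  { intros c Hc. pose proof (exp_ineq1_le c). nra. }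
  set (dpsi := fun c => c / 4 + p - p * exp c / (1 - p + p * exp c)).
  assert (Hd : forall c, 0 <= c -> 0 <= dpsi c).
  { intros c Hc.
    apply Rle_trans with (dpsi 0).
    - unfold dpsi. rewrite exp_0. right. field. lra.
    - apply (derive_nonneg_incr dpsi
        (fun c => (1 - p - p * exp c) ^ 2 / (4 * (1 - p + p * exp c) ^ 2))); auto.
      + intros b Hb. specialize (Hpos b Hb). unfold dpsi. auto_derive; [lra|]. field. lra.
      + intros b Hb. specialize (Hpos b Hb). apply Rle_mult_inv_pos; [apply pow2_ge_0|].
        apply Rmult_lt_0_compat; [lra|]. apply pow_lt; auto. }
  rewrite <- (exp_ln (1 - p + p * exp u)) by auto. apply exp_le.
  set (psi := fun u => p * u + u ^ 2 / 8 - ln (1 - p + p * exp u)).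
  cut (psi 0 <= psi u).
  - unfold psi. rewrite exp_0. replace (1 - p + p * 1) with 1 by ring. rewrite ln_1. lra.
  - apply (derive_nonneg_incr psi dpsi); auto. intros c Hc. specialize (Hpos c Hc).
    unfold psi, dpsi. auto_derive; [lra|]. field. lra.
Qed.

(** * Expectations under unnormalised weights *)

(** Dividing by the total mass lets Gibbs and Poisson laws be given by bare weights, so that
    conditioning is a factorisation of weights. *)
Definition Ex {X} (u F : X -> R) : R := tsum (fun x => u x * F x) / tsum u.

Lemma Ex_ext {X} (u F G : X -> R) : (forall x, F x = G x) -> Ex u F = Ex u G.
Proof. intros H. unfold Ex. f_equal. apply tsum_ext. intros x. now rewrite H. Qed.

Section Expectation.
Context {X : Type} (u : X -> R).
Hypothesis u_nonneg : forall x, 0 <= u x.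
Hypothesis u_summable : summable u.
Hypothesis u_pos : 0 < tsum u.

Definition integrable (F : X -> R) : Prop := summable (fun x => u x * F x).

Lemma integrable_plus F G : integrable F -> integrable G -> integrable (fun x => F x + G x).
Proof.
  intros HF HG. apply summable_ext with (2 := summable_plus _ _ HF HG). intros; ring.
Qed.

Lemma integrable_scal c F : integrable F -> integrable (fun x => c * F x).
Proof. intros HF. apply summable_ext with (2 := summable_scal c _ HF). intros; ring. Qed.

Lemma integrable_const c : integrable (fun _ => c).
Proof. apply summable_ext with (2 := summable_scal c _ u_summable). intros; ring. Qed.

Lemma integrable_dom F G : (forall x, Rabs (F x) <= G x) -> integrable G -> integrable F.
Proof.
  intros H HG. apply summable_dom with (2 := HG). intros x.
  rewrite Rabs_mult, (Rabs_pos_eq (u x)) by auto. now apply Rmult_le_compat_l.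
Qed.

Lemma Ex_plus F G : integrable F -> integrable G ->
  Ex u (fun x => F x + G x) = Ex u F + Ex u G.
Proof.
  intros HF HG. unfold Ex. rewrite <- Rdiv_plus_distr, <- tsum_plus by auto. f_equal.
  apply tsum_ext; intros; ring.
Qed.

Lemma Ex_scal c F : integrable F -> Ex u (fun x => c * F x) = c * Ex u F.
Proof.
  intros HF. unfold Ex, Rdiv. rewrite <- Rmult_assoc, <- tsum_scal by auto. f_equal.
  apply tsum_ext; intros; ring.
Qed.

Lemma Ex_const c : Ex u (fun _ => c) = c.
Proof.
  unfold Ex. rewrite (tsum_ext _ (fun x => c * u x)) by (intros; ring).
  rewrite tsum_scal by auto. field. lra.
Qed.

Lemma Ex_minus F G : integrable F -> integrable G ->
  Ex u (fun x => F x - G x) = Ex u F - Ex u G.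
Proof.
  intros HF HG. rewrite (Ex_ext u _ (fun x => F x + -1 * G x)) by (intros; ring).
  rewrite Ex_plus, Ex_scal by auto using integrable_scal. ring.
Qed.

Lemma Ex_le F G : integrable F -> integrable G -> (forall x, F x <= G x) -> Ex u F <= Ex u G.
Proof.
  intros HF HG H. unfold Ex. apply Rmult_le_compat_r; [now apply Rlt_le, Rinv_0_lt_compat|].
  apply tsum_le; auto. intros x. now apply Rmult_le_compat_l.
Qed.

Lemma Ex_Rabs_le F G : integrable F -> integrable G -> (forall x, Rabs (F x) <= G x) ->
  Rabs (Ex u F) <= Ex u G.
Proof.
  intros HF HG H. apply Rabs_le. split.
  - replace (- Ex u G) with (-1 * Ex u G) by ring. rewrite <- Ex_scal by auto.
    apply Ex_le; auto using integrable_scal. intros x. specialize (H x). apply Rabs_le_inv in H. lra.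
  - apply Ex_le; auto. intros x. specialize (H x). apply Rabs_le_inv in H. lra.
Qed.

(** Write [G = m + L y] with [y] in [[0, 1]] and bound [exp] by its chord: this reduces the claim to
    a Bernoulli variable with success probability [Ex u y], where [hoeffding_scalar] applies. *)
Lemma Ex_hoeffding G t m L : 0 <= t -> 0 <= L -> (forall x, m <= G x <= m + L) ->
  Ex u (fun x => exp (t * G x)) <= exp (t * Ex u G + t ^ 2 * L ^ 2 / 8).
Proof.
  intros Ht HL HG.
  assert (Hbd : forall F c, (forall x, Rabs (F x) <= c) -> integrable F).
  { intros F c H. apply integrable_dom with (fun _ => c); auto using integrable_const. }
  assert (HGi : integrable G).
  { apply Hbd with (Rabs m + L). intros x. specialize (HG x).
    unfold Rabs; repeat destruct Rcase_abs; lra. }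
  assert (HGe : integrable (fun x => exp (t * G x))).
  { apply Hbd with (exp (t * (m + L))). intros x. rewrite Rabs_pos_eq by apply Rlt_le, exp_pos.
    apply exp_le, Rmult_le_compat_l; auto. apply HG. }
  destruct HL as [HL|<-].
  - set (y := fun x => / L * (G x + - m)).
    assert (Hy : forall x, 0 <= y x <= 1).
    { intros x. unfold y. specialize (HG x). pose proof (Rinv_0_lt_compat L HL). split; [nra|].
      replace 1 with (/ L * L) by (field; lra). apply Rmult_le_compat_l; lra. }
    assert (Hyi : integrable y) by (apply integrable_scal, integrable_plus; auto using integrable_const).
    assert (Ey : Ex u y = (Ex u G - m) / L).
    { unfold y. rewrite Ex_scal, Ex_plus, Ex_const by auto using integrable_const, integrable_plus.
      field. lra. }
    assert (Hp : 0 <= Ex u y <= 1).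
    { split; [rewrite <- (Ex_const 0)|rewrite <- (Ex_const 1)]; apply Ex_le; auto using integrable_const; intros x; apply Hy. }
    apply Rle_trans with (Ex u (fun x => exp (t * m) * (1 + (exp (t * L) - 1) * y x))).
    + apply Ex_le; auto using integrable_scal, integrable_plus, integrable_const. intros x.
      replace (t * G x) with (t * m + y x * (t * L)) by (unfold y; field; lra).
      rewrite exp_plus. apply Rmult_le_compat_l; [apply Rlt_le, exp_pos|].
      (* convexity of exp, by its tangent line at [q * a] *)
      set (q := y x). set (a := t * L). specialize (Hy x). fold q in Hy.
      pose proof (exp_ineq1_le ((1 - q) * a)) as H1. pose proof (exp_ineq1_le (- (q * a))) as H2.
      pose proof (exp_pos (q * a)) as H3.
      assert (E1 : exp a = exp (q * a) * exp ((1 - q) * a)) by (rewrite <- exp_plus; f_equal; ring).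
      assert (E2 : 1 = exp (q * a) * exp (- (q * a))) by (rewrite <- exp_plus, Rplus_opp_r, exp_0; auto).
      assert (exp (q * a) * (1 + (1 - q) * a) <= exp a) by (rewrite E1; apply Rmult_le_compat_l; lra).
      assert (exp (q * a) * (1 + - (q * a)) <= 1) by (eapply Rle_trans; [apply Rmult_le_compat_l; [lra|exact H2]|lra]).
      nra.
    + rewrite Ex_scal, Ex_plus, Ex_const, Ex_scal
        by auto using integrable_scal, integrable_plus, integrable_const.
      replace (t * Ex u G + t ^ 2 * L ^ 2 / 8)
        with (t * m + (Ex u y * (t * L) + (t * L) ^ 2 / 8)) by (rewrite Ey; field; lra).
      rewrite exp_plus. apply Rmult_le_compat_l; [apply Rlt_le, exp_pos|].
      pose proof (hoeffding_scalar (Ex u y) (t * L) Hp).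
      eapply Rle_trans; [|apply H; nra]. lra.
  - assert (E : forall x, G x = m) by (intros x; specialize (HG x); lra).
    rewrite (Ex_ext u _ (fun _ => exp (t * m))) by (intros; now rewrite E).
    rewrite (Ex_ext u G (fun _ => m)) by auto. rewrite !Ex_const. apply exp_le. nra.
Qed.

End Expectation.

(** Only the oscillation of [G] is given; its infimum is [- s], with [s] the supremum of [- G]. *)
Lemma Ex_hoeffding_osc {X} (u : X -> R) (x0 : X) G t L :
  (forall x, 0 <= u x) -> summable u -> 0 < tsum u -> 0 <= t ->
  (forall x y, G x - G y <= L) ->
  Ex u (fun x => exp (t * G x)) <= exp (t * Ex u G + t ^ 2 * L ^ 2 / 8).
Proof.
  intros Hu Hs Hp Ht HG.
  destruct (completeness (fun r => exists x, r = - G x)) as [s [Hub Hlub]].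
  - exists (L - G x0). intros r (x & ->). specialize (HG x0 x). lra.
  - exists (- G x0). eauto.
  - apply Ex_hoeffding with (- s); auto.
    + specialize (HG x0 x0). lra.
    + intros x. split.
      * assert (- G x <= s) by (apply Hub; eauto). lra.
      * assert (s <= L - G x); [|lra]. apply Hlub. intros r (y & ->). specialize (HG x y). lra.
Qed.

(** * Poisson expectations of Lipschitz functions *)

(** The factor [exp (- lam)] is left out: with [lam = rate] it would depend on the configuration and
    spoil the factorisation in [gw_site]. *)
Definition pw (lam : R) (n : nat) : R := lam ^ n / INR (fact n).
Definition pois (lam : R) (f : nat -> R) : R := Ex (pw lam) f.

Lemma pw_nonneg lam n : 0 <= lam -> 0 <= pw lam n.
Proof. intros H. apply Rle_mult_inv_pos; [now apply pow_le|apply INR_fact_lt_0]. Qed.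

(** A finite set containing an initial segment is itself contained in a longer one, so its sum lies
    between two partial sums of the series. *)
Lemma infinite_sum_HS (f : nat -> R) s : (forall n, 0 <= f n) -> infinite_sum f s -> HS f s.
Proof.
  intros Hf H.
  assert (E : forall n, fsum f (seq 0 (S n)) = sum_f_R0 f n).
  { induction n as [|n IH]; [simpl; ring|]. rewrite seq_S, fsum_app, IH. simpl. ring. }
  intros e He. destruct (H e He) as [n0 Hn]. exists (seq 0 (S n0)). intros l Hl Hi.
  set (m := (n0 + list_max l)%nat).
  assert (Hm : incl l (seq 0 (S m))).
  { intros x Hx. apply in_seq. pose proof (proj1 (list_max_le l (list_max l)) (le_n _)) as HF.
    rewrite Forall_forall in HF. specialize (HF x Hx). unfold m. lia. }
  pose proof (fsum_incl f _ _ Hf (seq_NoDup _ _) Hi) as L1.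
  pose proof (fsum_incl f _ _ Hf Hl Hm) as L2. rewrite E in L1, L2.
  pose proof (Hn n0 (le_n _)) as B1. pose proof (Hn m ltac:(unfold m; lia)) as B2.
  unfold Rdist in *. apply Rabs_def2 in B1. apply Rabs_def2 in B2. apply Rabs_def1; lra.
Qed.

Lemma HS_pw lam : 0 <= lam -> HS (pw lam) (exp lam).
Proof.
  intros H. apply infinite_sum_HS; [intros; now apply pw_nonneg|].
  unfold exp. destruct (exist_exp lam) as [s Hs]. simpl.
  intros e He. destruct (Hs e He) as [n0 Hn]. exists n0. intros n Hn'.
  rewrite <- (sum_eq (fun i => / INR (fact i) * lam ^ i) (pw lam) n);
    [now apply Hn|intros; unfold pw, Rdiv; ring].
Qed.

Lemma tsum_pw lam : 0 <= lam -> tsum (pw lam) = exp lam.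
Proof. intros. now apply HS_tsum, HS_pw. Qed.

Lemma summable_pw lam : 0 <= lam -> summable (pw lam).
Proof. intros. apply HS_summable with (exp lam); [intros; now apply pw_nonneg|now apply HS_pw]. Qed.

Lemma tsum_pw_pos lam : 0 <= lam -> 0 < tsum (pw lam).
Proof. intros. rewrite tsum_pw by auto. apply exp_pos. Qed.

Definition expgrowth (A B : R) (f : nat -> R) : Prop :=
  0 <= B /\ forall n, Rabs (f n) <= A * B ^ n.

Lemma expgrowth_const c : expgrowth (Rabs c) 1 (fun _ => c).
Proof. split; [lra|]. intros n. rewrite pow1. lra. Qed.

(** The geometric factor is absorbed into the parameter: [lam ^ n * B ^ n = (lam * B) ^ n]. *)
Lemma expgrowth_integrable lam A B f : 0 <= lam -> expgrowth A B f -> integrable (pw lam) f.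
Proof.
  intros Hl [HB H]. apply summable_dom with (fun n => A * pw (lam * B) n).
  - intros n. rewrite Rabs_mult, (Rabs_pos_eq (pw lam n)) by now apply pw_nonneg.
    pose proof (pw_nonneg lam n Hl). specialize (H n).
    replace (A * pw (lam * B) n) with (pw lam n * (A * B ^ n));
      [now apply Rmult_le_compat_l|]. unfold pw. rewrite Rpow_mult_distr. unfold Rdiv. ring.
  - apply summable_scal, summable_pw. now apply Rmult_le_pos.
Qed.

(** * Binomial laws and their Poisson limit *)

Fixpoint binR (n j : nat) : R :=
  match n, j with
  | _, O => 1
  | O, S _ => 0
  | S n', S j' => binR n' j' + binR n' j
  end.

(** Both the bound by [n ^ j / j!] and the limit of the binomial weights follow from this ratio by
    induction on [j]. *)
Lemma binR_succ n j : INR (S j) * binR n (S j) = (INR n - INR j) * binR n j.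
Proof.
  revert j. induction n as [|n IH]; intros j.
  - destruct j; simpl; ring.
  - destruct j as [|j].
    + pose proof (IH 0%nat) as H. rewrite S_INR in *. simpl in *. destruct n; simpl in *; nra.
    + pose proof (IH j) as H1. pose proof (IH (S j)) as H2.
      change (binR (S n) (S (S j))) with (binR n (S j) + binR n (S (S j))).
      change (binR (S n) (S j)) with (binR n j + binR n (S j)).
      rewrite !S_INR in *. nra.
Qed.

Lemma binR_nonneg n j : 0 <= binR n j.
Proof. revert j. induction n as [|n IH]; intros [|j]; simpl; try lra. apply Rplus_le_le_0_compat; auto. Qed.

Lemma binR_le n j : binR n j <= INR n ^ j / INR (fact j).
Proof.
  induction j as [|j IH].
  - destruct n; simpl; lra.
  - pose proof (binR_succ n j) as H. pose proof (binR_nonneg n j) as H0.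
    pose proof (pos_INR j) as Hj. pose proof (pos_INR n) as Hn.
    pose proof (INR_fact_lt_0 j) as Hf.
    rewrite fact_simpl, mult_INR. simpl pow.
    apply Rmult_le_reg_l with (INR (S j)); [rewrite S_INR; lra|].
    replace (INR (S j) * (INR n * INR n ^ j / (INR (S j) * INR (fact j))))
      with (INR n * (INR n ^ j / INR (fact j))) by (field; rewrite S_INR; lra).
    rewrite H. nra.
Qed.

Lemma Un_cv_const c : Un_cv (fun _ => c) c.
Proof. intros e He. exists 0%nat. intros n _. unfold Rdist. rewrite Rminus_diag, Rabs_R0; auto. Qed.

Lemma Un_cv_ext u v l : (forall n, u n = v n) -> Un_cv u l -> Un_cv v l.
Proof. intros H. replace v with u; [auto|]. now apply functional_extensionality. Qed.

Lemma Un_cv_inv_succ : Un_cv (fun n => / INR (S n)) 0.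
Proof.
  intros e He. destruct (archimed_cor1 e He) as (n0 & H1 & H2). exists n0. intros n Hn.
  unfold Rdist. rewrite Rminus_0_r, Rabs_pos_eq by (apply Rlt_le, Rinv_0_lt_compat, lt_0_INR; lia).
  apply Rle_lt_trans with (2 := H1). apply Rinv_le_contravar; [apply lt_0_INR; lia|apply le_INR; lia].
Qed.

(** For [n] trials, consecutive weights have ratio [lam / (j + 1) * (1 - j / n)]. Sequences are
    indexed by [S n] to avoid division by zero. *)
Lemma binR_cv lam j : Un_cv (fun n => binR (S n) j * (lam / INR (S n)) ^ j) (pw lam j).
Proof.
  unfold pw. induction j as [|j IH].
  - simpl. replace (1 / 1) with (1 * 1) by field. apply Un_cv_const.
  - assert (Hj : INR (S j) <> 0) by (apply not_0_INR; lia).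
    replace (lam ^ S j / INR (fact (S j)))
      with (lam ^ j / INR (fact j) * (lam / INR (S j) * (1 - INR j * 0))).
    2: { rewrite fact_simpl, mult_INR. simpl pow. field. split; auto. apply INR_fact_neq_0. }
    apply Un_cv_ext with (fun n => binR (S n) j * (lam / INR (S n)) ^ j
      * (lam / INR (S j) * (1 - INR j * / INR (S n)))).
    + intros n. pose proof (binR_succ (S n) j) as H.
      assert (Hn : INR (S n) <> 0) by (apply not_0_INR; lia).
      replace (binR (S n) (S j)) with ((INR (S n) - INR j) * binR (S n) j / INR (S j))
        by (rewrite <- H; field; auto).
      rewrite <- tech_pow_Rmult. set (q := (lam / INR (S n)) ^ j). set (r := binR (S n) j). clearbody q r. field. auto.
    + apply CV_mult; auto. apply CV_mult; [apply Un_cv_const|].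
      apply CV_minus; [apply Un_cv_const|]. apply CV_mult; [apply Un_cv_const|apply Un_cv_inv_succ].
Qed.

Fixpoint preds (l : list nat) : list nat :=
  match l with [] => [] | O :: l => preds l | S n :: l => n :: preds l end.

Lemma preds_In n l : In n (preds l) <-> In (S n) l.
Proof.
  induction l as [|[|m] l IH]; simpl; [tauto| |].
  - rewrite IH. intuition discriminate.
  - rewrite IH. intuition congruence.
Qed.

Lemma preds_NoDup l : NoDup l -> NoDup (preds l).
Proof.
  induction 1 as [|[|m] l H Hl IH]; simpl; auto; constructor; auto. now rewrite preds_In.
Qed.

Lemma HS_shift (f : nat -> R) s :
  HS f s -> HS (fun n => match n with O => 0 | S m => f m end) s.
Proof.
  intros H e He. destruct (H e He) as [l0 H0]. exists (map S l0). intros l Hl Hi.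
  replace (fsum _ l) with (fsum f (preds l)).
  - apply H0; [now apply preds_NoDup|]. intros n Hn. apply preds_In, Hi, in_map, Hn.
  - clear. induction l as [|[|m] l IH]; simpl; auto; rewrite IH; ring.
Qed.

(* One Bernoulli step with success probability [th / (1 + th)]. *)
Definition binop (th : R) (f : nat -> R) (k : nat) : R := (f k + th * f (S k)) / (1 + th).

(** With the odds [th] as parameter, [n] Bernoulli steps give [j] successes the weight
    [binR n j * th ^ j], of total mass [(1 + th) ^ n]; Pascal's rule is the splitting by the first
    step. *)
Lemma binop_iter_HS th n f k : 0 <= th ->
  HS (fun j => binR n j * th ^ j * f (k + j)%nat) ((1 + th) ^ n * Nat.iter n (binop th) f k).
Proof.
  intros Ht. revert k. induction n as [|n IH]; intros k.
  - apply HS_ext with (fun j => indic (In j [0%nat]) * f (k + j)%nat).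
    + intros [|j]; simpl; [rewrite indic_true|rewrite indic_false]; simpl; auto; [ring|ring|].
      intros [E|[]]; discriminate.
    + replace (_ * _) with (fsum (fun j => f (k + j)%nat) [0%nat]).
      * apply HS_finite. repeat constructor. simpl; tauto.
      * simpl. rewrite Nat.add_0_r. ring.
  - apply HS_ext with (fun j => binR n j * th ^ j * f (k + j)%nat +
      match j with O => 0 | S i => th * (binR n i * th ^ i * f (S k + i)%nat) end).
    + intros [|j]; simpl.
      * destruct n; simpl; ring.
      * rewrite Nat.add_succ_r. ring.
    + replace ((1 + th) ^ S n * Nat.iter (S n) (binop th) f k) with
        ((1 + th) ^ n * Nat.iter n (binop th) f k
         + th * ((1 + th) ^ n * Nat.iter n (binop th) f (S k))).
      * apply HS_plus; auto.
        apply (HS_shift (fun i => th * (binR n i * th ^ i * f (S k + i)%nat))), HS_scal, IH.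
      * simpl. unfold binop at 3. field. lra.
Qed.

Lemma binop_const th n k : 0 <= th -> Nat.iter n (binop th) (fun _ => 1) k = 1.
Proof.
  intros Ht. revert k. induction n as [|n IH]; intros k; [reflexivity|].
  simpl. unfold binop. rewrite !IH. field. lra.
Qed.

(** Poisson limit theorem. The binomial weights with odds [lam / n] are dominated by [pw lam] and
    converge to it. The integrand 1 in the same statement gives the limit of the normalisation
    [(1 + lam / n) ^ n]. *)
Lemma pois_binop_cv lam A B f : 0 <= lam -> expgrowth A B f ->
  Un_cv (fun n => Nat.iter (S n) (binop (lam / INR (S n))) f 0%nat) (pois lam f).
Proof.
  intros Hl Hf.
  assert (Hth : forall n, 0 <= lam / INR (S n)).
  { intros n. apply Rle_mult_inv_pos; auto. apply lt_0_INR; lia. }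
  assert (Hnum : forall A' B' g, expgrowth A' B' g ->
    Un_cv (fun n => (1 + lam / INR (S n)) ^ S n * Nat.iter (S n) (binop (lam / INR (S n))) g 0%nat)
          (tsum (fun j => pw lam j * g j))).
  { intros A' B' g Hg.
    apply Un_cv_ext with (fun n => tsum (fun j => binR (S n) j * (lam / INR (S n)) ^ j * g j)).
    { intros n. apply HS_tsum. apply (binop_iter_HS _ (S n) g 0); auto. }
    apply tsum_dominated with (fun j => Rabs (pw lam j * g j)).
    - intros n j. rewrite !Rabs_mult. apply Rmult_le_compat_r; [apply Rabs_pos|].
      rewrite <- Rabs_mult, !Rabs_pos_eq;
        [|now apply pw_nonneg|apply Rmult_le_pos; [apply binR_nonneg|now apply pow_le]].
      assert (Hn : 0 < INR (S n)) by (apply lt_0_INR; lia).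
      replace (pw lam j) with (INR (S n) ^ j / INR (fact j) * (lam / INR (S n)) ^ j).
      + apply Rmult_le_compat_r; [now apply pow_le|apply binR_le].
      + unfold pw, Rdiv. rewrite Rpow_mult_distr, pow_inv. field.
        split; [apply INR_fact_neq_0|]. apply pow_nonzero; lra.
    - apply summable_abs. now apply (expgrowth_integrable lam A' B').
    - intros j. apply CV_mult; [apply binR_cv|apply Un_cv_const]. }
  pose proof (Hnum _ _ f Hf) as H1.
  pose proof (Hnum _ _ _ (expgrowth_const 1)) as H2.
  unfold pois, Ex. apply Un_cv_ext with
    (fun n => ((1 + lam / INR (S n)) ^ S n * Nat.iter (S n) (binop (lam / INR (S n))) f 0%nat)
      * / ((1 + lam / INR (S n)) ^ S n * Nat.iter (S n) (binop (lam / INR (S n))) (fun _ => 1) 0%nat)).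
  - intros n. rewrite binop_const by auto. field. apply pow_nonzero. specialize (Hth n). lra.
  - apply CV_mult; auto.
    apply (continuity_seq Rinv _ _); [|].
    + apply continuity_pt_inv; [apply derivable_continuous_pt, derivable_pt_id|].
      pose proof (tsum_pw_pos lam Hl). lra.
    + rewrite (tsum_ext (pw lam) (fun j => pw lam j * 1)) by (intros; ring). auto.
Qed.

(** * Lipschitz functions on the integers *)

Definition nlip (L : R) (f : nat -> R) : Prop := forall k, Rabs (f (S k) - f k) <= L.

Lemma nlip_dist L f n m : nlip L f -> Rabs (f n - f m) <= L * Rabs (INR n - INR m).
Proof.
  intros Hf.
  assert (H : forall m k, Rabs (f (m + k)%nat - f m) <= L * INR k).
  { intros m0 k. induction k as [|k IH].
    - rewrite Nat.add_0_r, Rminus_diag, Rabs_R0. simpl. lra.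
    - rewrite Nat.add_succ_r, S_INR. specialize (Hf (m0 + k)%nat).
      apply Rabs_le_inv in IH. apply Rabs_le_inv in Hf. apply Rabs_le. lra. }
  destruct (Nat.le_ge_cases m n) as [Hmn|Hmn].
  - replace n with (m + (n - m))%nat by lia. rewrite plus_INR.
    replace (INR m + INR (n - m) - INR m) with (INR (n - m)) by ring.
    rewrite (Rabs_pos_eq (INR _)) by apply pos_INR. apply H.
  - rewrite (Rabs_minus_sym (f n)), (Rabs_minus_sym (INR n)).
    replace m with (n + (m - n))%nat by lia. rewrite plus_INR.
    replace (INR n + INR (m - n) - INR n) with (INR (m - n)) by ring.
    rewrite (Rabs_pos_eq (INR _)) by apply pos_INR. apply H.
Qed.

Lemma INR_le_exp n : INR n <= exp 1 ^ n.
Proof.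
  replace (exp 1 ^ n) with (exp (INR n)).
  - pose proof (exp_ineq1_le (INR n)). lra.
  - induction n as [|n IH]; [apply exp_0|]. rewrite S_INR, exp_plus, IH. simpl. ring.
Qed.

Lemma exp_INR_mul t n : exp (t * INR n) = exp t ^ n.
Proof.
  induction n as [|n IH]; [simpl; now rewrite Rmult_0_r, exp_0|].
  rewrite S_INR, Rmult_plus_distr_l, exp_plus, IH, Rmult_1_r. simpl. ring.
Qed.

Lemma nlip_growth L f : nlip L f -> expgrowth (Rabs (f 0%nat) + L) (exp 1) f.
Proof.
  intros Hf. split; [apply Rlt_le, exp_pos|]. intros n.
  assert (HL : 0 <= L) by (eapply Rle_trans; [apply Rabs_pos|apply (Hf 0%nat)]).
  pose proof (nlip_dist L f n 0 Hf) as H. simpl INR in H.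
  rewrite Rminus_0_r, (Rabs_pos_eq (INR n)) in H by apply pos_INR.
  pose proof (Rabs_triang (f 0%nat) (f n - f 0%nat)) as H1.
  replace (f 0%nat + (f n - f 0%nat)) with (f n) in H1 by ring.
  pose proof (INR_le_exp n). assert (1 <= exp 1 ^ n).
  { apply pow_R1_Rle. pose proof (exp_ineq1_le 1). lra. }
  pose proof (Rabs_pos (f 0%nat)). nra.
Qed.

Lemma nlip_exp_growth L f t : 0 <= t -> nlip L f ->
  expgrowth (exp (t * f 0%nat)) (exp (t * L)) (fun n => exp (t * f n)).
Proof.
  intros Ht Hf. split; [apply Rlt_le, exp_pos|]. intros n.
  rewrite Rabs_pos_eq by apply Rlt_le, exp_pos.
  rewrite <- exp_INR_mul, <- exp_plus. apply exp_le.
  pose proof (nlip_dist L f n 0 Hf) as H. simpl INR in H.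
  rewrite Rminus_0_r, (Rabs_pos_eq (INR n)) in H by apply pos_INR.
  apply Rabs_le_inv in H. nra.
Qed.

Lemma binop_nlip th L f : 0 <= th -> nlip L f -> nlip L (binop th f).
Proof.
  intros Ht Hf k. unfold binop.
  replace (_ - _) with (/ (1 + th) * ((f (S k) - f k) + th * (f (S (S k)) - f (S k)))) by (field; lra).
  rewrite Rabs_mult, Rabs_pos_eq by (apply Rlt_le, Rinv_0_lt_compat; lra).
  apply Rmult_le_reg_l with (1 + th); [lra|].
  rewrite <- Rmult_assoc, Rinv_r, Rmult_1_l by lra.
  pose proof (Hf k) as H1. pose proof (Hf (S k)) as H2.
  apply Rabs_le_inv in H1. apply Rabs_le_inv in H2. apply Rabs_le. nra.
Qed.

Lemma binop_iter_nlip th L n f : 0 <= th -> nlip L f -> nlip L (Nat.iter n (binop th) f).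
Proof. intros Ht Hf. induction n; simpl; auto using binop_nlip. Qed.

Lemma binop_mono th f g k : 0 <= th -> (forall k, f k <= g k) -> binop th f k <= binop th g k.
Proof.
  intros Ht H. unfold binop. apply Rmult_le_compat_r; [apply Rlt_le, Rinv_0_lt_compat; lra|].
  pose proof (H k). pose proof (H (S k)). nra.
Qed.

Lemma binop_scal th c g k : 0 <= th -> binop th (fun k => c * g k) k = c * binop th g k.
Proof. intros. unfold binop. field. lra. Qed.

(** For success probability [eta <= th] and increment [s] of [t f], [1 + eta (e^s - 1) <= exp (eta s
    + eta hstar s)]; the first term restores the mean and the second is at most [th * hstar t]. *)
Lemma binop_laplace th t f k : 0 <= th -> 0 <= t -> nlip 1 f ->
  binop th (fun k => exp (t * f k)) k <= exp (th * hstar t) * exp (t * binop th f k).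
Proof.
  intros Ht Ht' Hf. rewrite <- exp_plus.
  set (eta := th / (1 + th)). set (s := t * (f (S k) - f k)).
  assert (Heta : 0 <= eta <= th).
  { unfold eta. split; [apply Rle_mult_inv_pos; lra|].
    apply Rmult_le_reg_r with (1 + th); [lra|]. unfold Rdiv.
    rewrite Rmult_assoc, Rinv_l by lra. nra. }
  assert (Hs : hstar s <= hstar t).
  { apply hstar_Rabs. unfold s. rewrite Rabs_mult, Rabs_pos_eq by auto. specialize (Hf k). nra. }
  replace (binop th (fun k => exp (t * f k)) k) with (exp (t * f k) * (1 + eta * (exp s - 1))).
  - apply Rle_trans with (exp (t * f k) * exp (eta * (exp s - 1))).
    + apply Rmult_le_compat_l; [apply Rlt_le, exp_pos|apply exp_ineq1_le].
    + rewrite <- exp_plus. apply exp_le.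
      replace (t * binop th f k) with (t * f k + eta * s) by (unfold binop, eta, s; field; lra).
      pose proof (hstar_nonneg t). unfold hstar in Hs at 1. nra.
  - unfold binop. replace (exp (t * f (S k))) with (exp (t * f k) * exp s)
      by (rewrite <- exp_plus; f_equal; unfold s; ring).
    unfold eta. field. lra.
Qed.

(** Tensorisation: each further step acts on a function that is still 1-Lipschitz, so it contributes
    one more [th * hstar t]. *)
Lemma binop_iter_laplace th t f n k : 0 <= th -> 0 <= t -> nlip 1 f ->
  Nat.iter n (binop th) (fun k => exp (t * f k)) k
    <= exp (INR n * th * hstar t) * exp (t * Nat.iter n (binop th) f k).
Proof.
  intros Ht Ht' Hf. revert k. induction n as [|n IH]; intros k.
  - simpl. rewrite !Rmult_0_l, exp_0. lra.
  - rewrite S_INR. simpl Nat.iter.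
    eapply Rle_trans; [apply binop_mono; [auto|apply IH]|].
    replace ((INR n + 1) * th * hstar t) with (INR n * th * hstar t + th * hstar t) by ring.
    rewrite exp_plus, (Rmult_assoc (exp _)).
    eapply Rle_trans; [|apply Rmult_le_compat_l; [apply Rlt_le, exp_pos|
      apply binop_laplace; auto using binop_iter_nlip]].
    right. apply (binop_scal _ _ (fun k => exp (t * Nat.iter n (binop th) f k))). auto.
Qed.

(** With [th = lam / n] the exponent [n * th * hstar t] equals [lam * hstar t] for every [n], so the
    bound passes to the limit. *)
Lemma pois_laplace lam t f : 0 <= lam -> 0 <= t -> nlip 1 f ->
  pois lam (fun k => exp (t * f k)) <= exp (lam * hstar t) * exp (t * pois lam f).
Proof.
  intros Hl Ht Hf.
  assert (Hth : forall n, 0 <= lam / INR (S n)).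
  { intros n. apply Rle_mult_inv_pos; auto. apply lt_0_INR; lia. }
  eapply Rle_cv_lim.
  2: eapply pois_binop_cv, nlip_exp_growth; eauto.
  2: { apply CV_mult; [apply Un_cv_const|].
       apply (continuity_seq exp (fun n => t * Nat.iter (S n) (binop (lam / INR (S n))) f 0%nat)).
       - apply derivable_continuous_pt, derivable_pt_exp.
       - apply CV_mult; [apply Un_cv_const|]. eapply pois_binop_cv, nlip_growth; eauto. }
  intros n. cbv beta.
  replace (lam * hstar t) with (INR (S n) * (lam / INR (S n)) * hstar t)
    by (field; apply not_0_INR; lia).
  apply binop_iter_laplace; auto.
Qed.

(** Changing the parameter of one step moves the mean by at most [L |th - th'|], as
    [(1 + th) (1 + th') >= 1]; averaging does not enlarge earlier differences. *)
Lemma binop_iter_diff th th' L f n k : 0 <= th -> 0 <= th' -> nlip L f ->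
  Rabs (Nat.iter n (binop th) f k - Nat.iter n (binop th') f k) <= L * (INR n * Rabs (th - th')).
Proof.
  intros Ht Ht' Hf. revert k. induction n as [|n IH]; intros k.
  - simpl. rewrite Rminus_diag, Rabs_R0. lra.
  - rewrite S_INR. simpl Nat.iter.
    set (g := Nat.iter n (binop th) f) in *. set (g' := Nat.iter n (binop th') f) in *.
    assert (H1 : Rabs (binop th g k - binop th' g k) <= L * Rabs (th - th')).
    { unfold binop.
      replace (_ - _) with ((th - th') * ((g (S k) - g k) * / ((1 + th) * (1 + th')))) by (field; lra).
      rewrite Rabs_mult, Rmult_comm. apply Rmult_le_compat_r; [apply Rabs_pos|].
      rewrite Rabs_mult, (Rabs_pos_eq (/ _)) by (apply Rlt_le, Rinv_0_lt_compat; nra).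
      pose proof (binop_iter_nlip th L n f Ht Hf k) as H. fold g in H.
      assert (/ ((1 + th) * (1 + th')) <= 1).
      { rewrite <- Rinv_1. apply Rinv_le_contravar; nra. }
      assert (0 < / ((1 + th) * (1 + th'))) by (apply Rinv_0_lt_compat; nra).
      pose proof (Rabs_pos (g (S k) - g k)). nra. }
    assert (H2 : Rabs (binop th' g k - binop th' g' k) <= L * (INR n * Rabs (th - th'))).
    { unfold binop.
      replace (_ - _) with (/ (1 + th') * ((g k - g' k) + th' * (g (S k) - g' (S k)))) by (field; lra).
      rewrite Rabs_mult, Rabs_pos_eq by (apply Rlt_le, Rinv_0_lt_compat; lra).
      apply Rmult_le_reg_l with (1 + th'); [lra|].
      rewrite <- Rmult_assoc, Rinv_r, Rmult_1_l by lra.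
      pose proof (IH k) as I1. pose proof (IH (S k)) as I2.
      apply Rabs_le_inv in I1. apply Rabs_le_inv in I2. apply Rabs_le. nra. }
    apply Rabs_le_inv in H1. apply Rabs_le_inv in H2. apply Rabs_le. lra.
Qed.

(** In transport distance two Poisson laws are no further apart than their parameters, because
    [n |lam / n - lam' / n|] is [|lam - lam'|] for every [n]. *)
Lemma pois_diff lam lam' L f : 0 <= lam -> 0 <= lam' -> nlip L f ->
  Rabs (pois lam f - pois lam' f) <= L * Rabs (lam - lam').
Proof.
  intros Hl Hl' Hf.
  assert (Hth : forall lam n, 0 <= lam -> 0 <= lam / INR (S n)).
  { intros lam0 n H0. apply Rle_mult_inv_pos; auto. apply lt_0_INR; lia. }
  eapply Rle_cv_lim.
  2: apply cv_cvabs, CV_minus; eapply pois_binop_cv, nlip_growth; eauto.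
  2: apply Un_cv_const.
  intros n. cbv beta. eapply Rle_trans; [apply binop_iter_diff with (L := L); auto|].
  right. rewrite <- Rdiv_minus_distr. unfold Rdiv.
  rewrite Rabs_mult, (Rabs_pos_eq (/ _)) by (apply Rlt_le, Rinv_0_lt_compat, lt_0_INR; lia).
  field. apply not_0_INR; lia.
Qed.

(** * Configurations *)

Lemma sum_idx_S N f : sum_idx (S N) f = sum_idx N f + f N.
Proof. unfold sum_idx. rewrite seq_S, fsum_app. simpl. ring. Qed.

Lemma sum_idx_ext N f g : (forall i, (i < N)%nat -> f i = g i) -> sum_idx N f = sum_idx N g.
Proof. intros H. apply fsum_ext. intros i Hi. apply in_seq in Hi. apply H. lia. Qed.

Lemma sum_idx_le N f g : (forall i, (i < N)%nat -> f i <= g i) -> sum_idx N f <= sum_idx N g.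
Proof. intros H. apply fsum_le. intros i Hi. apply in_seq in Hi. apply H. lia. Qed.

Lemma sum_idx_nonneg N f : (forall i, (i < N)%nat -> 0 <= f i) -> 0 <= sum_idx N f.
Proof. intros H. apply fsum_nonneg. intros i Hi. apply in_seq in Hi. apply H. lia. Qed.

Lemma sum_idx_plus N f g : sum_idx N (fun i => f i + g i) = sum_idx N f + sum_idx N g.
Proof. apply fsum_plus. Qed.

Lemma sum_idx_scal N c f : sum_idx N (fun i => c * f i) = c * sum_idx N f.
Proof. apply fsum_scal. Qed.

Lemma sum_idx_const N c : sum_idx N (fun _ => c) = INR N * c.
Proof. induction N as [|N IH]; [unfold sum_idx; simpl; ring|]. rewrite sum_idx_S, IH, S_INR. ring. Qed.

Lemma coord_ext N (x y : config N) : (forall i, (i < N)%nat -> coord x i = coord y i) -> x = y.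
Proof.
  destruct x as [l Hl], y as [l' Hl']. unfold coord. simpl. intros H.
  assert (l = l') as <-.
  { apply nth_ext with 0%nat 0%nat; [lia|]. intros i Hi. apply H. lia. }
  f_equal. apply Eqdep_dec.UIP_dec, Nat.eq_dec.
Qed.

Definition mkc (N : nat) (f : nat -> nat) : config N.
Proof. exists (map f (seq 0 N)). now rewrite length_map, length_seq. Defined.

Lemma coord_mkc N f i : (i < N)%nat -> coord (mkc N f) i = f i.
Proof.
  intros H. unfold coord, mkc. simpl.
  rewrite nth_indep with (d' := f 0%nat) by now rewrite length_map, length_seq.
  rewrite map_nth, seq_nth by auto. reflexivity.
Qed.

Definition updf (f : nat -> nat) (i m k : nat) : nat := if Nat.eqb k i then m else f k.

Lemma updf_same f i m : updf f i m i = m.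
Proof. unfold updf. now rewrite Nat.eqb_refl. Qed.

Lemma updf_other f i m k : k <> i -> updf f i m k = f k.
Proof. intros H. unfold updf. apply Nat.eqb_neq in H. now rewrite H. Qed.

Definition upd {N} (x : config N) (i m : nat) : config N := mkc N (updf (coord x) i m).
Definition snoc {N} (x : config N) (n : nat) : config (S N) := mkc (S N) (updf (coord x) N n).
Definition init {N} (x : config (S N)) : config N := mkc N (coord x).
Definition origin (N : nat) : config N := mkc N (fun _ => 0%nat).

Lemma coord_upd N (x : config N) i m k : (k < N)%nat -> coord (upd x i m) k = updf (coord x) i m k.
Proof. apply coord_mkc. Qed.

Lemma coord_snoc N (x : config N) n k : (k < N)%nat -> coord (snoc x n) k = coord x k.
Proof. intros H. unfold snoc. rewrite coord_mkc, updf_other; lia. Qed.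

Lemma coord_snoc_last N (x : config N) n : coord (snoc x n) N = n.
Proof. unfold snoc. rewrite coord_mkc, updf_same; lia. Qed.

Lemma init_snoc N (x : config N) n : init (snoc x n) = x.
Proof. apply coord_ext. intros i Hi. unfold init. rewrite coord_mkc, coord_snoc; auto. Qed.

Lemma snoc_init N (x : config (S N)) : snoc (init x) (coord x N) = x.
Proof.
  apply coord_ext. intros i Hi. destruct (Nat.eq_dec i N) as [->|Hn].
  - apply coord_snoc_last.
  - rewrite coord_snoc by lia. unfold init. apply coord_mkc. lia.
Qed.

Lemma config0_eq (x y : config 0) : x = y.
Proof. apply coord_ext. intros; lia. Qed.

Lemma rhoH_nonneg N (x y : config N) : 0 <= rhoH x y.
Proof. apply sum_idx_nonneg. intros; apply Rabs_pos. Qed.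

Lemma rhoH_refl N (x : config N) : rhoH x x = 0.
Proof. apply fsum_zero. intros. now rewrite Rminus_diag, Rabs_R0. Qed.

Lemma rhoH_sym N (x y : config N) : rhoH x y = rhoH y x.
Proof. apply sum_idx_ext. intros. apply Rabs_minus_sym. Qed.

Lemma rhoH_tri N (x y z : config N) : rhoH x z <= rhoH x y + rhoH y z.
Proof.
  unfold rhoH. rewrite <- sum_idx_plus. apply sum_idx_le. intros i _.
  eapply Rle_trans; [|apply Rabs_triang]. right. f_equal. ring.
Qed.

Lemma rhoH_snoc N (x y : config N) n m :
  rhoH (snoc x n) (snoc y m) = rhoH x y + Rabs (INR n - INR m).
Proof.
  unfold rhoH. rewrite sum_idx_S, !coord_snoc_last. f_equal. apply sum_idx_ext.
  intros i Hi. now rewrite !coord_snoc.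
Qed.

Lemma rhoH_upd N (x y : config N) i m m' : (i < N)%nat ->
  rhoH (upd x i m) (upd y i m')
    = rhoH x y - Rabs (INR (coord x i) - INR (coord y i)) + Rabs (INR m - INR m').
Proof.
  intros Hi. unfold rhoH.
  (* The change at site [i] is written as a sum over all sites, so that the identity can be checked
     term by term. *)
  assert (E : forall v, sum_idx N (fun k => indic (i = k) * v) = v).
  { intros v. unfold sum_idx. apply (fsum_indic_eq (fun _ => v)); [apply seq_NoDup|].
    apply in_seq. lia. }
  rewrite <- (E (Rabs (INR m - INR m'))), <- (E (Rabs (INR (coord x i) - INR (coord y i)))).
  unfold Rminus at 2. rewrite <- (Rmult_1_l (- _)), <- Ropp_mult_distr_r, Ropp_mult_distr_l.
  rewrite <- sum_idx_scal, <- !sum_idx_plus. apply sum_idx_ext. intros k Hk.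
  rewrite !coord_upd by auto. destruct (Nat.eq_dec k i) as [->|Hn].
  - rewrite !updf_same, indic_true by auto. ring.
  - rewrite !updf_other, indic_false by auto. ring.
Qed.

Definition tot {N} (x : config N) : R := sum_idx N (fun i => INR (coord x i)).

Lemma rhoH_origin N (x : config N) : rhoH x (origin N) = tot x.
Proof.
  apply sum_idx_ext. intros i Hi. unfold origin. rewrite coord_mkc by auto.
  simpl. rewrite Rminus_0_r. apply Rabs_pos_eq, pos_INR.
Qed.

Lemma tot_nonneg N (x : config N) : 0 <= tot x.
Proof. apply sum_idx_nonneg. intros; apply pos_INR. Qed.

Lemma tot_snoc N (x : config N) n : tot (snoc x n) = tot x + INR n.
Proof.
  unfold tot. rewrite sum_idx_S, coord_snoc_last. f_equal. apply sum_idx_ext.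
  intros i Hi. now rewrite coord_snoc.
Qed.

Lemma tot_upd N (x : config N) i m : tot (upd x i m) <= tot x + INR m.
Proof.
  rewrite <- !rhoH_origin. eapply Rle_trans; [apply rhoH_tri with (y := upd (origin N) i m)|].
  destruct (Nat.lt_ge_cases i N) as [Hi|Hi].
  - rewrite rhoH_upd by auto. rewrite Rminus_diag, Rabs_R0.
    replace (rhoH (upd (origin N) i m) (origin N)) with
      (rhoH (upd (origin N) i m) (upd (origin N) i 0)).
    + rewrite rhoH_upd by auto. rewrite rhoH_refl, Rminus_diag, Rabs_R0. simpl (INR 0).
      rewrite (Rminus_0_r (INR m)), (Rabs_pos_eq (INR m)) by apply pos_INR.
      pose proof (Rabs_pos (INR (coord x i) - INR (coord (origin N) i))). lra.
    + f_equal. apply coord_ext. intros k Hk. rewrite coord_upd by auto. unfold origin.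
      rewrite coord_mkc by auto. unfold updf. destruct Nat.eqb; auto. apply coord_mkc; auto.
  - assert (E : forall z : config N, upd z i m = z).
    { intros z. apply coord_ext. intros k Hk. rewrite coord_upd, updf_other; auto. lia. }
    rewrite !E, rhoH_refl. pose proof (pos_INR m). lra.
Qed.

(** * Gibbs weights *)

Fixpoint prodn (N : nat) (f : nat -> R) : R :=
  match N with O => 1 | S n => prodn n f * f n end.

Lemma prodn_ext N f g : (forall i, (i < N)%nat -> f i = g i) -> prodn N f = prodn N g.
Proof. induction N as [|N IH]; intros H; simpl; auto. rewrite IH, H; auto. Qed.

Lemma prodn_bounds N f : (forall i, (i < N)%nat -> 0 <= f i <= 1) -> 0 <= prodn N f <= 1.
Proof.
  induction N as [|N IH]; intros H; simpl; [lra|].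
  specialize (H N ltac:(lia)) as H1. assert (0 <= prodn N f <= 1) by auto. nra.
Qed.

Lemma prodn_pow N f k : prodn N (fun i => f i ^ k) = prodn N f ^ k.
Proof. induction N as [|N IH]; simpl; [now rewrite pow1|]. now rewrite IH, Rpow_mult_distr. Qed.

Lemma prodn_one N f : (forall i, (i < N)%nat -> f i = 1) -> prodn N f = 1.
Proof. induction N as [|N IH]; intros H; simpl; auto. rewrite IH, H; auto. ring. Qed.

Lemma prodn_extract N f g i : (i < N)%nat ->
  (forall k, (k < N)%nat -> k <> i -> f k = g k) -> g i = 1 -> prodn N f = prodn N g * f i.
Proof.
  induction N as [|N IH]; intros Hi H Hg; [lia|]. simpl.
  destruct (Nat.eq_dec i N) as [->|Hn].
  - rewrite Hg. rewrite (prodn_ext N f g) by (intros; apply H; lia). ring.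
  - rewrite IH; auto; [|lia]. rewrite (H N) by lia. ring.
Qed.

Lemma pow_unit b n : 0 <= b <= 1 -> 0 <= b ^ n <= 1.
Proof.
  intros H. split; [apply pow_le; lra|]. rewrite <- (pow1 n). apply pow_incr. lra.
Qed.

Lemma pow_unit_nlip b : 0 <= b <= 1 -> nlip (1 - b) (fun n => b ^ n).
Proof.
  intros Hb k. simpl. replace (b * b ^ k - b ^ k) with (- ((1 - b) * b ^ k)) by ring.
  pose proof (pow_unit b k Hb).
  rewrite Rabs_Ropp, Rabs_pos_eq; nra.
Qed.

(** Telescoping over the factors, all in [[0, 1]]. With [b j = e^(- gamma_ij)] the constants
    [1 - b j] are those of Dobrushin's condition. *)
Lemma prodn_pow_diff N (b : nat -> R) (x y : nat -> nat) :
  (forall i, 0 <= b i <= 1) ->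
  Rabs (prodn N (fun i => b i ^ x i) - prodn N (fun i => b i ^ y i))
    <= sum_idx N (fun i => (1 - b i) * Rabs (INR (x i) - INR (y i))).
Proof.
  intros Hb. induction N as [|N IH].
  - simpl. rewrite Rminus_diag, Rabs_R0. unfold sum_idx; simpl; lra.
  - rewrite sum_idx_S. simpl.
    set (p := prodn N (fun i => b i ^ x i)) in *. set (q := prodn N (fun i => b i ^ y i)) in *.
    assert (Hp : 0 <= p <= 1) by (apply prodn_bounds; intros; now apply pow_unit).
    pose proof (pow_unit (b N) (y N) (Hb N)) as Hy.
    pose proof (nlip_dist _ _ (x N) (y N) (pow_unit_nlip (b N) (Hb N))) as HN.
    set (r := b N ^ x N) in *. set (s := b N ^ y N) in *. cbv beta in HN.
    replace (p * r - q * s) with (s * (p - q) + p * (r - s)) by ring.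
    eapply Rle_trans; [apply Rabs_triang|]. rewrite !Rabs_mult, (Rabs_pos_eq s), (Rabs_pos_eq p) by lra.
    pose proof (Rabs_pos (p - q)). pose proof (Rabs_pos (r - s)). fold r s in HN. nra.
Qed.

Section Gibbs.
Context (a : nat -> nat -> R).
Hypothesis a_unit : forall i j, 0 <= a i j <= 1.
Hypothesis a_sym : forall i j, a i j = a j i.
Hypothesis a_diag : forall i, a i i = 1.

(** Here [a i j] stands for [e^(- gamma_ij)]; since [0 ^ 0 = 1], powers agree with the conventions
    for infinite [gamma_ij]. Coordinates are a function on all indices, so that the recursion on [N]
    stays in one type. *)
Fixpoint gw (N : nat) (delta : nat -> R) (x : nat -> nat) : R :=
  match N with
  | O => 1
  | S n => gw n delta x * prodn n (fun i => a i n ^ (x i * x n)) * pw (delta n) (x n)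
  end.

(** Parameter of the Poisson law of site [i] given the others; the factor [j = i] is 1 by
    [a_diag]. *)
Definition rate (N : nat) (delta : nat -> R) (i : nat) (x : nat -> nat) : R :=
  delta i * prodn N (fun j => a i j ^ x j).

Lemma gw_ext N delta x y : (forall i, (i < N)%nat -> x i = y i) -> gw N delta x = gw N delta y.
Proof.
  induction N as [|N IH]; intros H; simpl; auto.
  rewrite IH by auto. rewrite (H N) by lia. f_equal. f_equal. apply prodn_ext.
  intros i Hi. rewrite H; auto.
Qed.

Lemma gw_nonneg N delta x : (forall i, 0 <= delta i) -> 0 <= gw N delta x.
Proof.
  intros Hd. induction N as [|N IH]; simpl; [lra|].
  apply Rmult_le_pos; [apply Rmult_le_pos; auto|now apply pw_nonneg].
  apply prodn_bounds. intros; now apply pow_unit.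
Qed.

(** Multiplying the activities by [b] tilts the weight. With [b i = a i N ^ n] the tilt is the
    interaction with a last coordinate equal to [n]. *)
Lemma gw_scale N delta b x :
  gw N (fun i => delta i * b i) x = gw N delta x * prodn N (fun i => b i ^ x i).
Proof.
  induction N as [|N IH]; simpl; [ring|]. rewrite IH. unfold pw. rewrite Rpow_mult_distr.
  unfold Rdiv. ring.
Qed.

Lemma rate_updf N delta i x m : (i < N)%nat -> rate N delta i (updf x i m) = rate N delta i x.
Proof.
  intros Hi. unfold rate. f_equal. apply prodn_ext. intros k Hk.
  destruct (Nat.eq_dec k i) as [->|Hn]; [now rewrite a_diag, !pow1|now rewrite updf_other].
Qed.

Lemma rate_bounds N delta i x : 0 <= delta i -> 0 <= rate N delta i x <= delta i.
Proof.
  intros H. unfold rate.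
  assert (0 <= prodn N (fun j => a i j ^ x j) <= 1) by (apply prodn_bounds; intros; now apply pow_unit).
  nra.
Qed.

(** With the other sites fixed, the weight depends on [x i] through a Poisson weight of parameter
    [rate]. The last site collects its interactions by symmetry of [a]; an earlier site gains one
    factor at each recursion step. *)
Lemma gw_site N delta i x : (i < N)%nat ->
  gw N delta x = gw N delta (updf x i 0) * pw (rate N delta i x) (x i).
Proof.
  revert i. induction N as [|N IH]; intros i Hi; [lia|].
  destruct (Nat.eq_dec i N) as [->|Hn].
  - simpl. rewrite updf_same. unfold rate. simpl. rewrite a_diag, pow1, (Rmult_1_r (prodn _ _)).
    rewrite (gw_ext N delta (updf x N 0) x) by (intros; apply updf_other; lia).
    rewrite (prodn_one N (fun i => a i N ^ (updf x N 0 i * 0)))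
      by (intros; now rewrite Nat.mul_0_r).
    unfold pw. simpl (fact 0). simpl (_ ^ 0). simpl (INR 1).
    rewrite Rpow_mult_distr, <- prodn_pow.
    rewrite (prodn_ext N (fun i => (a N i ^ x i) ^ x N) (fun i => a i N ^ (x i * x N)))
      by (intros; now rewrite <- pow_mult, a_sym).
    field. apply INR_fact_neq_0.
  - simpl. rewrite (IH i) by lia. rewrite updf_other by lia.
    rewrite (prodn_extract N (fun k => a k N ^ (x k * x N))
      (fun k => a k N ^ (updf x i 0 k * x N)) i) by
      (try lia; try (now rewrite updf_same); intros; now rewrite updf_other).
    unfold rate. simpl. unfold pw.
    replace (a i N ^ (x i * x N)) with ((a i N ^ x N) ^ x i)
      by (rewrite <- pow_mult; f_equal; lia).
    rewrite !Rpow_mult_distr. unfold Rdiv. ring.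
Qed.

Definition gibbs (N : nat) (delta : nat -> R) (x : config N) : R := gw N delta (coord x).

Lemma gibbs_nonneg N delta x : (forall i, 0 <= delta i) -> 0 <= gibbs N delta x.
Proof. apply gw_nonneg. Qed.

Definition shrink (delta : nat -> R) (N n i : nat) : R := delta i * a i N ^ n.

Lemma shrink_bounds delta N n i : 0 <= delta i -> 0 <= shrink delta N n i <= delta i.
Proof. intros H. unfold shrink. pose proof (pow_unit (a i N) n (a_unit i N)). nra. Qed.

Lemma gibbs_snoc N delta x n :
  gibbs (S N) delta (snoc x n) = gibbs N (shrink delta N n) x * pw (delta N) n.
Proof.
  unfold gibbs, shrink. rewrite gw_scale. simpl. rewrite coord_snoc_last.
  rewrite (gw_ext N delta (coord (snoc x n)) (coord x)) by (intros; now apply coord_snoc).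
  f_equal. f_equal. apply prodn_ext. intros i Hi.
  rewrite coord_snoc, <- pow_mult by auto. f_equal. lia.
Qed.

Lemma gibbs_mono N delta b x : (forall i, 0 <= delta i) -> (forall i, 0 <= b i <= 1) ->
  gibbs N (fun i => delta i * b i) x <= gibbs N delta x.
Proof.
  intros Hd Hb. unfold gibbs. rewrite gw_scale. pose proof (gw_nonneg N delta (coord x) Hd).
  assert (0 <= prodn N (fun i => b i ^ coord x i) <= 1)
    by (apply prodn_bounds; intros; now apply pow_unit).
  nra.
Qed.

(** * Integrability under Gibbs weights *)

Lemma summable_prod {X Y} (f : X -> R) (g : Y -> R) :
  (forall x, 0 <= f x) -> (forall y, 0 <= g y) -> summable f -> summable g ->
  summable (fun xy => f (fst xy) * g (snd xy)).
Proof.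
  intros Hf Hg Sf Sg. apply summable_tonelli with (fun x => f x * tsum g).
  - intros x. simpl. apply HS_ext with (fun y => f x * g y).
    + intros y. rewrite Rabs_pos_eq; auto. now apply Rmult_le_pos.
    + now apply HS_scal, summable_tsum.
  - apply summable_ext with (fun x => tsum g * f x); [intros; ring|]. now apply summable_scal.
Qed.

Lemma summable_config0 (f : config 0 -> R) : summable f.
Proof.
  exists (Rabs (f (origin 0))). intros l Hl.
  replace (Rabs (f (origin 0))) with (fsum (fun x => Rabs (f x)) [origin 0]) by (simpl; ring).
  apply fsum_incl; auto using Rabs_pos. intros x _. left. apply config0_eq.
Qed.

(** Interaction factors are at most 1, so the weight of a configuration is bounded by that of its
    first [N] coordinates times a Poisson weight, and Poisson laws have all exponential moments. *)
Lemma integrable_exp_tot N delta t : (forall i, 0 <= delta i) ->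
  integrable (gibbs N delta) (fun x => exp (t * tot x)).
Proof.
  intros Hd. unfold integrable. induction N as [|N IH]; [apply summable_config0|].
  set (f := fun xn : config N * nat =>
    (gibbs N delta (fst xn) * exp (t * tot (fst xn))) * (pw (delta N) (snd xn) * exp t ^ snd xn)).
  apply summable_dom with (fun x : config (S N) => f (init x, coord x N)).
  - intros x. rewrite <- (snoc_init N x) at 1 2. unfold f. simpl.
    rewrite gibbs_snoc, tot_snoc, Rmult_plus_distr_l, exp_plus, exp_INR_mul.
    pose proof (gibbs_mono N delta (fun i => a i N ^ coord x N) (init x) Hd
      (fun i => pow_unit _ _ (a_unit i N))) as H.
    change (fun i => delta i * a i N ^ coord x N) with (shrink delta N (coord x N)) in H.
    assert (H0 : 0 <= gibbs N (shrink delta N (coord x N)) (init x))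
      by (apply gibbs_nonneg; intros; now apply shrink_bounds).
    pose proof (pw_nonneg (delta N) (coord x N) (Hd N)) as H1.
    pose proof (exp_pos (t * tot (init x))) as H2.
    pose proof (pow_le (exp t) (coord x N) (Rlt_le _ _ (exp_pos t))) as H3.
    assert (0 <= pw (delta N) (coord x N) * (exp (t * tot (init x)) * exp t ^ coord x N))
      by (apply Rmult_le_pos; auto; apply Rmult_le_pos; lra).
    rewrite Rabs_pos_eq.
    + rewrite Rmult_assoc. eapply Rle_trans; [apply Rmult_le_compat_r; eassumption|]. right. ring.
    + rewrite Rmult_assoc. now apply Rmult_le_pos.
  - apply (summable_inj (fun x : config (S N) => (init x, coord x N)) f).
    + intros x x' E. rewrite <- (snoc_init N x), <- (snoc_init N x'). congruence.
    + apply (summable_prod (fun x : config N => gibbs N delta x * exp (t * tot x))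
        (fun n => pw (delta N) n * exp t ^ n)).
      * intros x. apply Rmult_le_pos; [now apply gibbs_nonneg|apply Rlt_le, exp_pos].
      * intros n. apply Rmult_le_pos; [now apply pw_nonneg|apply pow_le, Rlt_le, exp_pos].
      * auto.
      * apply (expgrowth_integrable (delta N) 1 (exp t)); auto.
        split; [apply Rlt_le, exp_pos|]. intros n.
        rewrite Rabs_pos_eq by (apply pow_le, Rlt_le, exp_pos). lra.
Qed.

Lemma gibbs_summable N delta : (forall i, 0 <= delta i) -> summable (gibbs N delta).
Proof.
  intros Hd. apply summable_ext with (2 := integrable_exp_tot N delta 0 Hd).
  intros x. rewrite Rmult_0_l, exp_0. ring.
Qed.

Lemma gibbs_pos N delta : (forall i, 0 <= delta i) -> 0 < tsum (gibbs N delta).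
Proof.
  intros Hd. apply Rlt_le_trans with (fsum (gibbs N delta) [origin N]).
  - simpl. replace (gibbs N delta (origin N)) with 1; [lra|].
    unfold gibbs. rewrite (gw_ext N delta _ (fun _ => 0%nat)) by (intros; now apply coord_mkc).
    clear. induction N as [|N IH]; simpl; auto. rewrite <- IH, prodn_one by auto. unfold pw. simpl. field.
  - apply HS_nonneg_ge; [intros; now apply gibbs_nonneg|now apply summable_tsum, gibbs_summable|].
    repeat constructor. simpl; tauto.
Qed.

(** A class of integrands that contains [F] and [exp (t * F)] for Lipschitz [F] and [t >= 0], and is
    integrable under every Gibbs weight. *)
Definition cgrowth {N} (A t : R) (F : config N -> R) : Prop :=
  0 <= A /\ 0 <= t /\ forall x, Rabs (F x) <= A * exp (t * tot x).

Lemma cgrowth_integrable N delta A t F :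
  (forall i, 0 <= delta i) -> cgrowth A t F -> integrable (gibbs N delta) F.
Proof.
  intros Hd (HA & Ht & H). apply integrable_dom with (fun x => A * exp (t * tot x)); auto.
  - intros; now apply gibbs_nonneg.
  - now apply integrable_scal, integrable_exp_tot.
Qed.

Lemma lip_cgrowth N L (F : config N -> R) : 0 <= L -> lipschitz rhoH L F ->
  cgrowth (Rabs (F (origin N)) + L) 1 F.
Proof.
  intros HL HF. split; [|split; [lra|]].
  - pose proof (Rabs_pos (F (origin N))). lra.
  - intros x. pose proof (lipschitz_Rabs rhoH (rhoH_sym N) L F x (origin N) HF) as H.
    rewrite rhoH_origin in H.
    pose proof (Rabs_triang (F (origin N)) (F x - F (origin N))) as H1.
    replace (F (origin N) + (F x - F (origin N))) with (F x) in H1 by ring.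
    rewrite Rmult_1_l. pose proof (exp_ineq1_le (tot x)). pose proof (tot_nonneg N x).
    pose proof (Rabs_pos (F (origin N))). nra.
Qed.

Lemma exp_lip_cgrowth N L t (F : config N -> R) : 0 <= L -> 0 <= t -> lipschitz rhoH L F ->
  cgrowth (exp (t * F (origin N))) (t * L) (fun x => exp (t * F x)).
Proof.
  intros HL Ht HF. split; [apply Rlt_le, exp_pos|split; [now apply Rmult_le_pos|]].
  intros x. rewrite Rabs_pos_eq by apply Rlt_le, exp_pos. rewrite <- exp_plus. apply exp_le.
  specialize (HF x (origin N)). rewrite rhoH_origin in HF. nra.
Qed.

Definition gibbsE (N : nat) (delta : nat -> R) (F : config N -> R) : R := Ex (gibbs N delta) F.

(** * Heat-bath dynamics *)

(** Resamples site [i] from its conditional law given the others. *)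
Definition heat {N} (delta : nat -> R) (i : nat) (F : config N -> R) (x : config N) : R :=
  pois (rate N delta i (coord x)) (fun m => F (upd x i m)).

Lemma rate_upd N delta i (x : config N) m : (i < N)%nat ->
  rate N delta i (coord (upd x i m)) = rate N delta i (coord x).
Proof.
  intros Hi. rewrite <- (rate_updf N delta i (coord x) m) by auto. unfold rate. f_equal.
  apply prodn_ext. intros k Hk. now rewrite coord_upd.
Qed.

Lemma upd_upd N (x : config N) i m : upd (upd x i m) i (coord x i) = x.
Proof.
  apply coord_ext. intros k Hk. rewrite coord_upd by auto.
  destruct (Nat.eq_dec k i) as [->|Hn]; [now rewrite updf_same|].
  rewrite updf_other, coord_upd, updf_other; auto.
Qed.

Lemma cgrowth_upd N A t (F : config N -> R) x i : cgrowth A t F ->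
  expgrowth (A * exp (t * tot x)) (exp t) (fun m => F (upd x i m)).
Proof.
  intros (HA & Ht & H). split; [apply Rlt_le, exp_pos|]. intros m.
  eapply Rle_trans; [apply H|]. rewrite Rmult_assoc. apply Rmult_le_compat_l; auto.
  rewrite <- exp_INR_mul, <- exp_plus. apply exp_le.
  rewrite <- Rmult_plus_distr_l. apply Rmult_le_compat_l; auto. apply tot_upd.
Qed.

(* Detailed balance: the integrand on pairs (x, m), m being the resampled value of site i,
   is invariant under exchanging m with the i-th coordinate of x. *)
Lemma gibbsE_heat N delta i (F : config N -> R) A t :
  (forall i, 0 <= delta i) -> (i < N)%nat -> cgrowth A t F ->
  gibbsE N delta (heat delta i F) = gibbsE N delta F.
Proof.
  intros Hd Hi HF. unfold gibbsE, Ex. f_equal.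
  set (lam := fun x : config N => rate N delta i (coord x)).
  assert (Hlam : forall x, 0 <= lam x) by (intros; apply rate_bounds; auto).
  set (k := fun (x : config N) m => exp (- lam x) * pw (lam x) m).
  assert (Hk : forall x m, 0 <= k x m).
  { intros. apply Rmult_le_pos; [apply Rlt_le, exp_pos|now apply pw_nonneg]. }
  assert (Hk1 : forall x, HS (k x) 1).
  { intros x. replace 1 with (exp (- lam x) * exp (lam x)).
    - now apply HS_scal, HS_pw.
    - rewrite <- exp_plus, Rplus_opp_l. apply exp_0. }
  set (g0 := fun xm : config N * nat => gibbs N delta (fst xm) * F (fst xm) * k (fst xm) (snd xm)).
  assert (Hrow0 : forall x, HS (fun m => g0 (x, m)) (gibbs N delta x * F x)).
  { intros x. rewrite <- (Rmult_1_r (_ * F x)).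
    exact (HS_scal (gibbs N delta x * F x) (k x) 1 (Hk1 x)). }
  assert (HwF : summable (fun x => gibbs N delta x * F x)) by (eapply cgrowth_integrable; eauto).
  assert (Hg0 : summable g0).
  { apply summable_tonelli with (fun x => Rabs (gibbs N delta x * F x)).
    - intros x. unfold g0. simpl.
      apply HS_ext with (fun m => Rabs (gibbs N delta x * F x) * k x m).
      + intros m. now rewrite (Rabs_mult _ (k x m)), (Rabs_pos_eq (k x m)).
      + pose proof (HS_scal (Rabs (gibbs N delta x * F x)) (k x) 1 (Hk1 x)) as H.
        now rewrite Rmult_1_r in H.
    - now apply summable_abs. }
  pose proof (summable_tsum g0 Hg0) as HS0.
  set (phi := fun xm : config N * nat => (upd (fst xm) i (snd xm), coord (fst xm) i)).
  assert (Hphi : forall xm, phi (phi xm) = xm).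
  { intros [x m]. unfold phi. simpl. rewrite upd_upd, coord_upd, updf_same; auto. }
  pose proof (HS_bij phi phi g0 _ Hphi Hphi HS0) as HS1.
  assert (Hrow1 : forall x, HS (fun m => g0 (phi (x, m))) (gibbs N delta x * heat delta i F x)).
  { intros x.
    apply HS_ext with (fun m => (gibbs N delta x * exp (- lam x)) * (pw (lam x) m * F (upd x i m))).
    - intros m. unfold g0, phi, k, lam. simpl. rewrite rate_upd by auto. fold (lam x).
      (* Both configurations factor through the one with site [i] emptied, and they share the rate;
         the two Poisson weights then trade places. *)
      unfold gibbs. rewrite (gw_site N delta i (coord x)), (gw_site N delta i (coord (upd x i m))) by auto.
      rewrite rate_upd, (coord_upd N x i m i), updf_same by auto. fold (lam x).
      rewrite (gw_ext N delta (updf (coord (upd x i m)) i 0) (updf (coord x) i 0)).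
      + ring.
      + intros j Hj. unfold updf. destruct (Nat.eqb j i) eqn:Ej; auto.
        rewrite coord_upd by auto. unfold updf. now rewrite Ej.
    - unfold heat, pois, Ex. fold (lam x). rewrite tsum_pw by auto.
      replace (gibbs N delta x * (_ / _)) with
        ((gibbs N delta x * exp (- lam x)) * tsum (fun m => pw (lam x) m * F (upd x i m)))
        by (rewrite exp_Ropp; unfold Rdiv; ring).
      apply HS_scal, summable_tsum. eapply expgrowth_integrable; auto. eapply cgrowth_upd; eauto. }
  rewrite (HS_tsum _ _ (HS_fubini _ _ _ Hrow1 HS1)).
  now rewrite (HS_tsum _ _ (HS_fubini _ _ _ Hrow0 HS0)).
Qed.

(** * Comparison of Gibbs measures *)

Definition dob_le (N : nat) (delta : nat -> R) (D : R) : Prop :=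
  forall j, (j < N)%nat -> sum_idx N (fun i => delta i * (1 - a i j)) <= D.

Lemma lip_upd_nlip N L (F : config N -> R) x i : (i < N)%nat -> lipschitz rhoH L F ->
  nlip L (fun m => F (upd x i m)).
Proof.
  intros Hi HF m. eapply Rle_trans; [apply lipschitz_Rabs; [apply rhoH_sym|apply HF]|].
  rewrite rhoH_upd, rhoH_refl, Rminus_diag, Rabs_R0, S_INR by auto.
  replace (INR m + 1 - INR m) with 1 by ring. rewrite Rabs_R1. right. ring.
Qed.

(** Two effects: with a common resampled value the configurations differ as [x] and [y] do off site
    [i], and the Poisson parameters differ by the weighted discrepancies of [prodn_pow_diff], which
    [pois_diff] turns into a difference of means. *)
Lemma heat_lip N delta L (F : config N -> R) i x y :
  (forall i, 0 <= delta i) -> 0 <= L -> (i < N)%nat -> lipschitz rhoH L F ->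
  heat delta i F x - heat delta i F y <=
    L * (rhoH x y - Rabs (INR (coord x i) - INR (coord y i)) +
         sum_idx N (fun j => delta i * (1 - a i j) * Rabs (INR (coord x j) - INR (coord y j)))).
Proof.
  intros Hd HL Hi HF. unfold heat.
  set (lx := rate N delta i (coord x)). set (ly := rate N delta i (coord y)).
  assert (Hlx : 0 <= lx) by (apply rate_bounds; auto).
  assert (Hly : 0 <= ly) by (apply rate_bounds; auto).
  set (fx := fun m => F (upd x i m)). set (fy := fun m => F (upd y i m)).
  assert (Nx : nlip L fx) by now apply lip_upd_nlip.
  assert (Ny : nlip L fy) by now apply lip_upd_nlip.
  set (r := rhoH x y - Rabs (INR (coord x i) - INR (coord y i))).
  assert (H1 : pois lx fx <= pois lx fy + L * r).
  { unfold pois. rewrite <- (Ex_const (pw lx) (summable_pw lx Hlx) (tsum_pw_pos lx Hlx) (L * r)).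
    rewrite <- Ex_plus.
    - apply Ex_le; auto using tsum_pw_pos.
      + intros; now apply pw_nonneg.
      + eapply expgrowth_integrable, nlip_growth; eauto.
      + apply integrable_plus; [eapply expgrowth_integrable, nlip_growth; eauto|].
        apply integrable_const, summable_pw; auto.
      + intros m. specialize (HF (upd x i m) (upd y i m)).
        rewrite rhoH_upd, Rminus_diag, Rabs_R0, Rplus_0_r in HF by auto. fold r in HF.
        unfold fx, fy. lra.
    - eapply expgrowth_integrable, nlip_growth; eauto.
    - apply integrable_const, summable_pw; auto. }
  pose proof (pois_diff lx ly L fy Hlx Hly Ny) as H2. apply Rabs_le_inv in H2.
  assert (H3 : Rabs (lx - ly) <=
    sum_idx N (fun j => delta i * (1 - a i j) * Rabs (INR (coord x j) - INR (coord y j)))).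
  { unfold lx, ly, rate. rewrite <- Rmult_minus_distr_l, Rabs_mult, (Rabs_pos_eq (delta i)) by auto.
    eapply Rle_trans; [apply Rmult_le_compat_l; [auto|apply prodn_pow_diff; auto]|].
    rewrite <- sum_idx_scal. right. apply sum_idx_ext. intros; ring. }
  nra.
Qed.

(** This is [N] times the heat-bath operator at a uniformly chosen site; the sum spares a division
    by [N]. *)
Definition sweep {N} (delta : nat -> R) (F : config N -> R) (x : config N) : R :=
  sum_idx N (fun i => heat delta i F x).

(** Summing [heat_lip] over the sites, the discrepancy at [j] survives [N - 1] of the resamplings
    and influences them by the column sum of [delta i * (1 - a i j)] over [i], at most [D]. *)
Lemma sweep_lip N delta D L (F : config N -> R) :
  (forall i, 0 <= delta i) -> 0 <= L -> dob_le N delta D -> lipschitz rhoH L F ->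
  lipschitz rhoH (L * (INR N - 1 + D)) (sweep delta F).
Proof.
  intros Hd HL HD HF x y. unfold sweep.
  set (e := fun j => Rabs (INR (coord x j) - INR (coord y j))).
  apply Rle_trans with (sum_idx N (fun i =>
    L * (rhoH x y - e i + sum_idx N (fun j => delta i * (1 - a i j) * e j)))).
  - unfold Rminus at 1. rewrite <- (Rmult_1_l (sum_idx N (fun i => heat delta i F y))),
      Ropp_mult_distr_l, <- sum_idx_scal, <- sum_idx_plus. apply sum_idx_le. intros i Hi.
    pose proof (heat_lip N delta L F i x y Hd HL Hi HF). unfold e. lra.
  - rewrite sum_idx_scal, Rmult_assoc. apply Rmult_le_compat_l; auto.
    rewrite sum_idx_plus.
    rewrite (sum_idx_ext N (fun i => rhoH x y - e i) (fun i => rhoH x y + -1 * e i)) by (intros; ring).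
    rewrite sum_idx_plus, sum_idx_const, sum_idx_scal.
    change (sum_idx N e) with (rhoH x y).
    assert (sum_idx N (fun i => sum_idx N (fun j => delta i * (1 - a i j) * e j)) <= D * rhoH x y).
    { unfold sum_idx at 1 2. rewrite fsum_swap.
      change (rhoH x y) with (sum_idx N e). rewrite <- sum_idx_scal. apply sum_idx_le. intros j Hj.
      rewrite (fsum_ext _ (fun i => e j * (delta i * (1 - a i j)))) by (intros; ring).
      rewrite fsum_scal, Rmult_comm. apply Rmult_le_compat_r; [apply Rabs_pos|]. apply HD, Hj. }
    lra.
Qed.

Lemma Ex_fsum {X I} (u : X -> R) (G : I -> X -> R) l :
  summable u -> 0 < tsum u -> (forall i, In i l -> integrable u (G i)) ->
  Ex u (fun x => fsum (fun i => G i x) l) = fsum (fun i => Ex u (G i)) l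
  /\ integrable u (fun x => fsum (fun i => G i x) l).
Proof.
  intros Hu Hp. induction l as [|i l IH]; intros H; simpl.
  - split; [now apply Ex_const|now apply integrable_const].
  - destruct IH as [E1 I1]; [auto with datatypes|]. split.
    + rewrite Ex_plus by auto with datatypes. now rewrite E1.
    + apply integrable_plus; auto with datatypes.
Qed.

(** There are two families of activities because the comparison integrates the dynamics of one Gibbs
    measure against the other. *)
Lemma heat_integrable N delta delta' L i (F : config N -> R) :
  (forall i, 0 <= delta i) -> (forall i, 0 <= delta' i) -> 0 <= L -> (i < N)%nat ->
  lipschitz rhoH L F -> integrable (gibbs N delta') (heat delta i F).
Proof.
  intros Hd Hd' HL Hi HF.
  assert (HK : lipschitz rhoH (L * (1 + delta i)) (heat delta i F)).
  { intros x y. eapply Rle_trans; [apply heat_lip; eauto|]. rewrite Rmult_assoc.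
    apply Rmult_le_compat_l; auto.
    assert (sum_idx N (fun j => delta i * (1 - a i j) * Rabs (INR (coord x j) - INR (coord y j)))
      <= delta i * rhoH x y).
    { unfold rhoH. rewrite <- sum_idx_scal. apply sum_idx_le. intros j _.
      pose proof (Rabs_pos (INR (coord x j) - INR (coord y j))). pose proof (a_unit i j).
      specialize (Hd i). apply Rmult_le_compat_r; nra. }
    pose proof (Rabs_pos (INR (coord x i) - INR (coord y i))). lra. }
  eapply cgrowth_integrable; [auto|]. apply (lip_cgrowth N (L * (1 + delta i))); auto.
  apply Rmult_le_pos; auto. specialize (Hd i). lra.
Qed.

Lemma gibbsE_sweep N delta L (F : config N -> R) :
  (forall i, 0 <= delta i) -> 0 <= L -> lipschitz rhoH L F ->
  gibbsE N delta (sweep delta F) = INR N * gibbsE N delta F.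
Proof.
  intros Hd HL HF. unfold gibbsE, sweep, sum_idx.
  rewrite (proj1 (Ex_fsum (gibbs N delta) (fun i => heat delta i F) (seq 0 N)
    (gibbs_summable N delta Hd) (gibbs_pos N delta Hd)
    (fun i Hi => heat_integrable N delta delta L i F Hd Hd HL (proj2 (proj1 (in_seq _ _ _) Hi)) HF))).
  rewrite <- sum_idx_const. apply sum_idx_ext. intros i Hi.
  eapply (gibbsE_heat N delta i F); eauto. eapply lip_cgrowth; eauto.
Qed.

(* Dobrushin's comparison theorem: the supremum m of the differences of expectations over 1-Lipschitz F
   satisfies N m <= (N - 1 + D) m + sum_i |delta_i - delta'_i| by invariance under a sweep. *)
Lemma gibbsE_perturb N delta delta' D (F : config N -> R) :
  (forall i, 0 <= delta i) -> (forall i, 0 <= delta' i) -> 0 <= D < 1 -> dob_le N delta D ->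
  lipschitz rhoH 1 F ->
  gibbsE N delta F - gibbsE N delta' F <= sum_idx N (fun i => Rabs (delta i - delta' i)) / (1 - D).
Proof.
  intros Hd Hd' HD Hdob HF.
  set (Dl := sum_idx N (fun i => Rabs (delta i - delta' i))).
  assert (HDl : 0 <= Dl) by (apply sum_idx_nonneg; intros; apply Rabs_pos).
  destruct (Nat.eq_dec N 0) as [->|HN0].
  { assert (Ec : forall d, (forall i, 0 <= d i) -> gibbsE 0 d F = F (origin 0)).
    { intros d Hd0. unfold gibbsE. rewrite (Ex_ext _ F (fun _ => F (origin 0))).
      - apply Ex_const; auto using gibbs_summable, gibbs_pos.
      - intros x. f_equal. apply config0_eq. }
    rewrite !Ec by auto. rewrite Rminus_diag. apply Rle_mult_inv_pos; lra. }
  assert (HN : 1 <= INR N) by (change 1 with (INR 1); apply le_INR; lia).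
  assert (Hi : forall (d : nat -> R) L (G : config N -> R), (forall i, 0 <= d i) -> 0 <= L ->
    lipschitz rhoH L G -> integrable (gibbs N d) G).
  { intros d L G Hd0 HL HG. eapply cgrowth_integrable, lip_cgrowth; eauto. }
  assert (Htot : lipschitz rhoH 1 (@tot N)).
  { intros x y. rewrite <- !rhoH_origin. pose proof (rhoH_tri N x y (origin N)). lra. }
  assert (Hu : forall d, (forall i, 0 <= d i) -> forall x, 0 <= gibbs N d x)
    by (intros; now apply gibbs_nonneg).
  (* A bound uniform in [G], so that the supremum [m] is finite and can be cancelled in the final
     inequality. *)
  assert (Hbd : forall (d : nat -> R) (G : config N -> R), (forall i, 0 <= d i) -> lipschitz rhoH 1 G ->
    Rabs (gibbsE N d G - G (origin N)) <= gibbsE N d (@tot N)).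
  { intros d G Hd0 HG. unfold gibbsE.
    rewrite <- (Ex_const (gibbs N d) (gibbs_summable N d Hd0) (gibbs_pos N d Hd0) (G (origin N))).
    assert (Hc : integrable (gibbs N d) (fun _ => G (origin N))) by now apply integrable_const, gibbs_summable.
    rewrite <- Ex_minus by eauto using Rle_0_1.
    apply Ex_Rabs_le; eauto using gibbs_pos, Rle_0_1.
    - apply summable_ext with (fun x => gibbs N d x * (G x + -1 * G (origin N))); [intros; ring|].
      apply integrable_plus; eauto using Rle_0_1. now apply integrable_const, gibbs_summable.
    - intros x. rewrite <- rhoH_origin, <- (Rmult_1_l (rhoH _ _)).
      apply lipschitz_Rabs; auto. apply rhoH_sym. }
  destruct (completeness (fun r => exists G, lipschitz rhoH 1 G /\ r = gibbsE N delta G - gibbsE N delta' G))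
    as [m [Hub Hlub]].
  { exists (gibbsE N delta (@tot N) + gibbsE N delta' (@tot N)). intros r (G & HG & ->).
    pose proof (Hbd delta G Hd HG) as B1. pose proof (Hbd delta' G Hd' HG) as B2.
    apply Rabs_le_inv in B1. apply Rabs_le_inv in B2. lra. }
  { exists (gibbsE N delta F - gibbsE N delta' F). eauto. }
  assert (HFm : gibbsE N delta F - gibbsE N delta' F <= m) by (apply Hub; eauto).
  assert (Hscale : forall K G, 0 <= K -> lipschitz rhoH K G -> gibbsE N delta G - gibbsE N delta' G <= K * m).
  { intros K G [HK|<-] HG.
    - assert (HG1 : lipschitz rhoH 1 (fun x => / K * G x)).
      { intros x y. specialize (HG x y). rewrite <- Rmult_minus_distr_l.
        replace (1 * rhoH x y) with (/ K * (K * rhoH x y)) by (field; lra).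
        apply Rmult_le_compat_l; auto. now apply Rlt_le, Rinv_0_lt_compat. }
      assert (Hm : gibbsE N delta (fun x => / K * G x) - gibbsE N delta' (fun x => / K * G x) <= m)
        by (apply Hub; eauto).
      unfold gibbsE in *. rewrite !Ex_scal in Hm by (eapply Hi; [| |exact HG]; auto; lra).
      rewrite <- Rmult_minus_distr_l in Hm. apply (Rmult_le_compat_l K) in Hm; [|lra].
      rewrite <- Rmult_assoc, Rinv_r, Rmult_1_l in Hm by lra. auto.
    - assert (Ec : forall x, G x = G (origin N)).
      { intros x. pose proof (HG x (origin N)). pose proof (HG (origin N) x). lra. }
      unfold gibbsE. rewrite !(Ex_ext _ G (fun _ => G (origin N))) by auto.
      rewrite !Ex_const by auto using gibbs_summable, gibbs_pos. lra. }
  (* Invariance turns the left side into [E (S G) - E' (S' G)], where [S] and [S'] are the two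
     sweeps. Splitting at [E' (S G)], the Lipschitz constant of [S G] bounds one part by
     [(N - 1 + D) m], and [S G - S' G] is at most [Dl] pointwise. *)
  assert (Hstep : forall G, lipschitz rhoH 1 G ->
    INR N * (gibbsE N delta G - gibbsE N delta' G) <= (INR N - 1 + D) * m + Dl).
  { intros G HG.
    pose proof (gibbsE_sweep N delta 1 G Hd Rle_0_1 HG) as S1.
    pose proof (gibbsE_sweep N delta' 1 G Hd' Rle_0_1 HG) as S2.
    pose proof (sweep_lip N delta D 1 G Hd Rle_0_1 Hdob HG) as S3.
    rewrite Rmult_1_l in S3.
    assert (HK : 0 <= INR N - 1 + D) by lra.
    pose proof (Hscale _ _ HK S3) as S4.
    assert (S5 : integrable (gibbs N delta') (sweep delta G)) by eauto.
    assert (S6 : integrable (gibbs N delta') (sweep delta' G)).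
    { apply (Ex_fsum (gibbs N delta') (fun i => heat delta' i G) (seq 0 N)
        (gibbs_summable N delta' Hd') (gibbs_pos N delta' Hd')).
      intros i Hin. apply in_seq in Hin. apply (heat_integrable N delta' delta' 1); auto using Rle_0_1; lia. }
    assert (S7 : gibbsE N delta' (sweep delta G) <= gibbsE N delta' (sweep delta' G) + Dl).
    { unfold gibbsE. rewrite <- (Ex_const (gibbs N delta') (gibbs_summable N delta' Hd') (gibbs_pos N delta' Hd') Dl).
      assert (Hc : integrable (gibbs N delta') (fun _ => Dl)) by now apply integrable_const, gibbs_summable.
      rewrite <- Ex_plus by auto. apply Ex_le; auto using gibbs_pos, integrable_plus.
      intros x. unfold sweep, Dl. rewrite <- sum_idx_plus. apply sum_idx_le. intros i Hlt.
      unfold heat.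
      pose proof (pois_diff (rate N delta i (coord x)) (rate N delta' i (coord x)) 1
        (fun m => G (upd x i m)) (proj1 (rate_bounds _ _ _ _ (Hd i)))
        (proj1 (rate_bounds _ _ _ _ (Hd' i))) (lip_upd_nlip N 1 G x i Hlt HG)) as B.
      apply Rabs_le_inv in B.
      assert (Rabs (rate N delta i (coord x) - rate N delta' i (coord x)) <= Rabs (delta i - delta' i)).
      { unfold rate. rewrite <- Rmult_minus_distr_r, Rabs_mult.
        assert (Hb : 0 <= prodn N (fun j => a i j ^ coord x j) <= 1)
          by (apply prodn_bounds; intros; now apply pow_unit).
        rewrite (Rabs_pos_eq (prodn _ _)) by lra. pose proof (Rabs_pos (delta i - delta' i)). nra. }
      lra. }
    rewrite Rmult_minus_distr_l. lra. }
  assert (HNp : 0 < INR N) by (apply lt_0_INR; lia).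
  assert (Hm : INR N * m <= (INR N - 1 + D) * m + Dl).
  { assert (m <= ((INR N - 1 + D) * m + Dl) / INR N).
    { apply Hlub. intros r (G & HG & ->). specialize (Hstep G HG).
      apply Rmult_le_reg_l with (INR N); auto.
      replace (INR N * (((INR N - 1 + D) * m + Dl) / INR N)) with ((INR N - 1 + D) * m + Dl)
        by (field; lra). auto. }
    apply (Rmult_le_compat_l (INR N)) in H; [|lra].
    replace (INR N * (((INR N - 1 + D) * m + Dl) / INR N)) with ((INR N - 1 + D) * m + Dl) in H
      by (field; lra). auto. }
  apply Rle_trans with m; auto. apply Rmult_le_reg_r with (1 - D); [lra|].
  unfold Rdiv. rewrite Rmult_assoc, Rinv_l by lra. lra.
Qed.

(** * Laplace transforms under the Dobrushin condition *)

(** Total expectation over the last coordinate, whose unnormalised law gives [n] the mass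
    [pw (delta N) n] times a partition function. *)
Lemma gibbsE_cond N delta (F : config (S N) -> R) :
  (forall i, 0 <= delta i) -> integrable (gibbs (S N) delta) F ->
  (forall n, integrable (gibbs N (shrink delta N n)) (fun x => F (snoc x n))) ->
  HS (fun n => pw (delta N) n * tsum (gibbs N (shrink delta N n))
               * gibbsE N (shrink delta N n) (fun x => F (snoc x n)))
     (tsum (fun x => gibbs (S N) delta x * F x)).
Proof.
  intros Hd HF Hn.
  apply HS_fubini with
    (f := fun nx : nat * config N => gibbs (S N) delta (snoc (snd nx) (fst nx)) * F (snoc (snd nx) (fst nx))).
  - intros n. simpl. unfold gibbsE, Ex.
    apply HS_ext with (fun x => pw (delta N) n * (gibbs N (shrink delta N n) x * F (snoc x n))).
    + intros x. rewrite gibbs_snoc. ring.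
    + replace (_ * _ * _) with (pw (delta N) n * tsum (fun x => gibbs N (shrink delta N n) x * F (snoc x n))).
      * apply HS_scal, summable_tsum, Hn.
      * field. apply Rgt_not_eq, gibbs_pos. intros; now apply shrink_bounds.
  - apply (HS_bij (fun nx : nat * config N => snoc (snd nx) (fst nx))
      (fun x => (coord x N, init x)) (fun x => gibbs (S N) delta x * F x)).
    + intros [n x]. simpl. now rewrite coord_snoc_last, init_snoc.
    + intros x. simpl. apply snoc_init.
    + now apply summable_tsum.
Qed.

Lemma gibbsE_cond_le N delta (F G : config (S N) -> R) :
  (forall i, 0 <= delta i) ->
  integrable (gibbs (S N) delta) F -> integrable (gibbs (S N) delta) G ->
  (forall n, integrable (gibbs N (shrink delta N n)) (fun x => F (snoc x n))) ->
  (forall n, integrable (gibbs N (shrink delta N n)) (fun x => G (snoc x n))) ->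
  (forall n, gibbsE N (shrink delta N n) (fun x => F (snoc x n))
             <= gibbsE N (shrink delta N n) (fun x => G (snoc x n))) ->
  gibbsE (S N) delta F <= gibbsE (S N) delta G.
Proof.
  intros Hd HF HG HFn HGn H. unfold gibbsE at 1 2, Ex. apply Rmult_le_compat_r.
  - apply Rlt_le, Rinv_0_lt_compat. now apply gibbs_pos.
  - eapply HS_le; [|apply gibbsE_cond; eauto|apply gibbsE_cond; eauto]. intros n. cbv beta.
    apply Rmult_le_compat_l; auto. apply Rmult_le_pos; [now apply pw_nonneg|].
    apply Rlt_le, gibbs_pos. intros; now apply shrink_bounds.
Qed.

Lemma last_lip N L g : nlip L g -> lipschitz rhoH L (fun x : config (S N) => g (coord x N)).
Proof.
  intros Hg x y. pose proof (nlip_dist L g (coord x N) (coord y N) Hg) as H.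
  assert (HL : 0 <= L) by (eapply Rle_trans; [apply Rabs_pos|apply (Hg 0%nat)]).
  apply Rabs_le_inv in H. unfold rhoH. rewrite sum_idx_S.
  assert (0 <= sum_idx N (fun i => Rabs (INR (coord x i) - INR (coord y i))))
    by (apply sum_idx_nonneg; intros; apply Rabs_pos).
  nra.
Qed.

(* The last coordinate is a mixture of Poisson laws with parameters in [0, delta N]: the Poisson
   fluctuations contribute [delta N], Hoeffding's lemma for the mixing law [delta N ^ 2 / 4]. *)
Lemma last_laplace N delta L t g : (forall i, 0 <= delta i) -> 0 < L -> 0 <= t -> nlip L g ->
  gibbsE (S N) delta (fun x => exp (t * g (coord x N))) <=
    exp (t * gibbsE (S N) delta (fun x => g (coord x N))
         + (delta N + delta N ^ 2 / 4) * hstar (t * L)).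
Proof.
  intros Hd HL Ht Hg.
  pose proof (last_lip N L g Hg) as HG.
  assert (HLt : 0 <= t * L) by nra.
  set (lam := fun x : config (S N) => rate (S N) delta N (coord x)).
  assert (Hlam : forall x, 0 <= lam x <= delta N) by (intros; apply rate_bounds; auto).
  assert (Hheat : forall (f : nat -> R) x, heat delta N (fun x : config (S N) => f (coord x N)) x = pois (lam x) f).
  { intros f x. unfold heat. fold (lam x). unfold pois. apply Ex_ext. intros m.
    rewrite coord_upd, updf_same by lia. reflexivity. }
  (* Resampling the last site replaces a function of it by its mean under a Poisson law with random
     parameter [lam x]: this exhibits the mixture. *)
  rewrite <- (gibbsE_heat (S N) delta N _ _ _ Hd (Nat.lt_succ_diag_r N)
    (exp_lip_cgrowth _ L t _ (Rlt_le _ _ HL) Ht HG)).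
  rewrite <- (gibbsE_heat (S N) delta N _ _ _ Hd (Nat.lt_succ_diag_r N)
    (lip_cgrowth _ L _ (Rlt_le _ _ HL) HG)).
  unfold gibbsE. rewrite (Ex_ext _ _ _ (Hheat (fun n => exp (t * g n)))), (Ex_ext _ _ _ (Hheat g)).
  set (gb := fun x => pois (lam x) g).
  (* As [lam] ranges over [[0, delta N]], the conditional mean oscillates by at most [L * delta N];
     Hoeffding's lemma then yields the exponent [t ^ 2 * (L * delta N) ^ 2 / 8]. *)
  assert (Hgb : forall x y, gb x - gb y <= L * delta N).
  { intros x y. pose proof (Hlam x). pose proof (Hlam y).
    pose proof (pois_diff (lam x) (lam y) L g (proj1 (Hlam x)) (proj1 (Hlam y)) Hg) as H1.
    apply Rabs_le_inv in H1. unfold gb.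
    assert (Rabs (lam x - lam y) <= delta N) by (apply Rabs_le; lra). nra. }
  assert (Hpt : forall x, pois (lam x) (fun n => exp (t * g n))
    <= exp (delta N * hstar (t * L)) * exp (t * gb x)).
  { intros x.
    (* [pois_laplace] is stated for slope 1, hence the rescaling by [L]. *)
    assert (Hf : nlip 1 (fun n => / L * g n)).
    { intros k. rewrite <- Rmult_minus_distr_l, Rabs_mult, Rabs_pos_eq
        by now apply Rlt_le, Rinv_0_lt_compat.
      replace 1 with (/ L * L) by (field; lra). apply Rmult_le_compat_l; auto.
      now apply Rlt_le, Rinv_0_lt_compat. }
    pose proof (pois_laplace (lam x) (t * L) _ (proj1 (Hlam x)) HLt Hf) as H.
    unfold pois in H.
    rewrite Ex_scal in H by (eapply expgrowth_integrable, nlip_growth; eauto; apply Hlam).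
    rewrite (Ex_ext _ _ (fun n => exp (t * g n))) in H by (intros; f_equal; field; lra).
    replace (t * L * (/ L * Ex (pw (lam x)) g)) with (t * gb x) in H
      by (unfold gb, pois; field; lra).
    eapply Rle_trans; [exact H|]. apply Rmult_le_compat_r; [apply Rlt_le, exp_pos|].
    apply exp_le, Rmult_le_compat_r; [apply hstar_nonneg|apply Hlam]. }
  assert (Hbd : forall G M, (forall x, Rabs (G x) <= M) -> integrable (gibbs (S N) delta) G).
  { intros G M H. apply integrable_dom with (fun _ => M); auto.
    - intros; now apply gibbs_nonneg.
    - now apply integrable_const, gibbs_summable. }
  assert (Hgbe : forall x, exp (t * gb x) <= exp (t * (gb (origin (S N)) + L * delta N))).
  { intros x. apply exp_le, Rmult_le_compat_l; auto. specialize (Hgb x (origin (S N))). lra. }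
  assert (Ie : integrable (gibbs (S N) delta) (fun x => exp (t * gb x))).
  { eapply Hbd. intros x. rewrite Rabs_pos_eq by apply Rlt_le, exp_pos. apply Hgbe. }
  eapply Rle_trans.
  - apply Ex_le with (G := fun x => exp (delta N * hstar (t * L)) * exp (t * gb x)); auto.
    + intros; now apply gibbs_nonneg.
    + now apply gibbs_pos.
    + apply Hbd with (exp (delta N * hstar (t * L)) * exp (t * (gb (origin (S N)) + L * delta N))).
      intros x. rewrite Rabs_pos_eq.
      * eapply Rle_trans; [apply Hpt|]. apply Rmult_le_compat_l; [apply Rlt_le, exp_pos|auto].
      * unfold pois. rewrite <- (Ex_const (pw (lam x)) (summable_pw _ (proj1 (Hlam x)))
          (tsum_pw_pos _ (proj1 (Hlam x))) 0).
        apply Ex_le; auto.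
        -- intros; apply pw_nonneg, Hlam.
        -- apply tsum_pw_pos, Hlam.
        -- apply integrable_const, summable_pw, Hlam.
        -- eapply expgrowth_integrable, nlip_exp_growth; eauto. apply Hlam.
        -- intros; apply Rlt_le, exp_pos.
    + now apply integrable_scal.
  - rewrite Ex_scal by auto.
    replace (t * _ + _) with (delta N * hstar (t * L)
      + (t * Ex (gibbs (S N) delta) gb + delta N ^ 2 / 4 * hstar (t * L))) by (unfold gb; ring).
    rewrite exp_plus. apply Rmult_le_compat_l; [apply Rlt_le, exp_pos|].
    eapply Rle_trans.
    + apply (Ex_hoeffding_osc (gibbs (S N) delta) (origin (S N)) gb t (L * delta N)); auto.
      * intros; now apply gibbs_nonneg.
      * now apply gibbs_summable.
      * now apply gibbs_pos.
    + apply exp_le. pose proof (hstar_quadratic (t * L) HLt). pose proof (pow2_ge_0 (delta N)).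
      replace (t ^ 2 * (L * delta N) ^ 2 / 8) with (delta N ^ 2 / 4 * ((t * L) ^ 2 / 2)) by field.
      nra.
Qed.

Lemma dob_le_shrink N delta D n : (forall i, 0 <= delta i) -> dob_le (S N) delta D ->
  dob_le N (shrink delta N n) D.
Proof.
  intros Hd H j Hj. specialize (H j ltac:(lia)). rewrite sum_idx_S in H.
  assert (0 <= delta N * (1 - a N j)).
  { pose proof (a_unit N j). apply Rmult_le_pos; auto; lra. }
  apply Rle_trans with (sum_idx N (fun i => delta i * (1 - a i j))); [|lra].
  apply sum_idx_le. intros i _. pose proof (a_unit i j).
  pose proof (shrink_bounds delta N n i (Hd i)). apply Rmult_le_compat_r; lra.
Qed.

Lemma snoc_lip N L (F : config (S N) -> R) n : lipschitz rhoH L F ->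
  lipschitz rhoH L (fun x => F (snoc x n)).
Proof.
  intros HF x y. specialize (HF (snoc x n) (snoc y n)).
  rewrite rhoH_snoc, Rminus_diag, Rabs_R0, Rplus_0_r in HF. auto.
Qed.

Lemma gibbsE_snoc_nlip N delta D (F : config (S N) -> R) :
  (forall i, 0 <= delta i) -> 0 <= D < 1 -> dob_le (S N) delta D -> lipschitz rhoH 1 F ->
  nlip (/ (1 - D)) (fun n => gibbsE N (shrink delta N n) (fun x => F (snoc x n))).
Proof.
  intros Hd HD Hdob HF.
  assert (Hs : forall n i, 0 <= shrink delta N n i) by (intros; now apply shrink_bounds).
  assert (HI : forall n m, integrable (gibbs N (shrink delta N n)) (fun x => F (snoc x m))).
  { intros n m. eapply cgrowth_integrable, lip_cgrowth with (L := 1); auto using snoc_lip; lra. }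
  assert (H : forall n m, gibbsE N (shrink delta N n) (fun x => F (snoc x n))
    - gibbsE N (shrink delta N m) (fun x => F (snoc x m)) <= / (1 - D) * Rabs (INR n - INR m)).
  { intros n m. set (r := Rabs (INR n - INR m)).
    assert (H1 : gibbsE N (shrink delta N n) (fun x => F (snoc x n))
      <= gibbsE N (shrink delta N n) (fun x => F (snoc x m)) + r).
    { unfold gibbsE. rewrite <- (Ex_const (gibbs N (shrink delta N n)) (gibbs_summable _ _ (Hs n)) (gibbs_pos _ _ (Hs n)) r).
      assert (Hc : integrable (gibbs N (shrink delta N n)) (fun _ => r)) by now apply integrable_const, gibbs_summable.
      rewrite <- Ex_plus by auto. apply Ex_le; auto using gibbs_pos, integrable_plus.
      - intros; now apply gibbs_nonneg.
      - intros x. specialize (HF (snoc x n) (snoc x m)). rewrite rhoH_snoc, rhoH_refl in HF.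
        unfold r. lra. }
    pose proof (gibbsE_perturb N (shrink delta N n) (shrink delta N m) D (fun x => F (snoc x m))
      (Hs n) (Hs m) HD (dob_le_shrink N delta D n Hd Hdob) (snoc_lip N 1 F m HF)) as H2.
    (* Column [N] of Dobrushin's condition, whose diagonal term vanishes, bounds the total change of
       the activities. *)
    assert (H3 : sum_idx N (fun i => Rabs (shrink delta N n i - shrink delta N m i)) <= D * r).
    { pose proof (Hdob N ltac:(lia)) as HN. rewrite sum_idx_S, a_diag, Rminus_diag, Rmult_0_r in HN.
      apply Rle_trans with (r * sum_idx N (fun i => delta i * (1 - a i N))).
      - rewrite <- sum_idx_scal. apply sum_idx_le. intros i _. unfold shrink.
        rewrite <- Rmult_minus_distr_l, Rabs_mult, Rabs_pos_eq by auto.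
        pose proof (nlip_dist _ _ n m (pow_unit_nlip (a i N) (a_unit i N))) as B.
        cbv beta in B. fold r in B. specialize (Hd i). nra.
      - assert (0 <= r) by apply Rabs_pos. nra. }
    assert (H4 : sum_idx N (fun i => Rabs (shrink delta N n i - shrink delta N m i)) / (1 - D)
      <= D * r / (1 - D)).
    { apply Rmult_le_compat_r; auto. apply Rlt_le, Rinv_0_lt_compat. lra. }
    replace (/ (1 - D) * r) with (r + D * r / (1 - D)) by (field; lra). lra. }
  intros k. pose proof (H (S k) k) as H1. pose proof (H k (S k)) as H2.
  rewrite Rabs_minus_sym in H2. rewrite S_INR in H1, H2.
  replace (INR k + 1 - INR k) with 1 in * by ring. rewrite Rabs_R1, Rmult_1_r in *.
  apply Rabs_le. lra.
Qed.

(** The activities are quantified inside the induction since conditioning changes them. Given the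
    last coordinate [n], the hypothesis bounds the conditional Laplace transform by
    [exp (c h + t g n)] with [g] the conditional mean; the Laplace transform of [g], a function of
    one coordinate, is left to [last_laplace]. *)
Lemma gibbsE_laplace N : forall delta D t (F : config N -> R),
  (forall i, 0 <= delta i) -> 0 <= D < 1 -> dob_le N delta D -> 0 <= t -> lipschitz rhoH 1 F ->
  gibbsE N delta (fun x => exp (t * F x)) <=
    exp (t * gibbsE N delta F + sum_idx N (fun i => delta i + delta i ^ 2 / 4) * hstar (t / (1 - D))).
Proof.
  induction N as [|N IH]; intros delta D t F Hd HD Hdob Ht HF.
  - unfold gibbsE. rewrite (Ex_ext _ (fun x => exp (t * F x)) (fun _ => exp (t * F (origin 0))))
      by (intros x; now rewrite (config0_eq x (origin 0))).
    rewrite (Ex_ext _ F (fun _ => F (origin 0))) by (intros x; now rewrite (config0_eq x (origin 0))).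
    rewrite !Ex_const by auto using gibbs_summable, gibbs_pos. apply exp_le. unfold sum_idx. simpl. lra.
  - assert (Hs : forall n i, 0 <= shrink delta N n i) by (intros; now apply shrink_bounds).
    set (g := fun n => gibbsE N (shrink delta N n) (fun x => F (snoc x n))).
    pose proof (gibbsE_snoc_nlip N delta D F Hd HD Hdob HF) as Hg. fold g in Hg.
    assert (HL : 0 < / (1 - D)) by (apply Rinv_0_lt_compat; lra).
    pose proof (last_lip N _ g Hg) as HG.
    assert (IF : integrable (gibbs (S N) delta) F)
      by (eapply cgrowth_integrable, lip_cgrowth with (L := 1); auto; lra).
    assert (IG : integrable (gibbs (S N) delta) (fun x => g (coord x N)))
      by (eapply cgrowth_integrable, lip_cgrowth with (L := / (1 - D)); auto; lra).
    assert (IFn : forall n, integrable (gibbs N (shrink delta N n)) (fun x => F (snoc x n)))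
      by (intros n; eapply cgrowth_integrable, lip_cgrowth with (L := 1); auto using snoc_lip; lra).
    assert (IC : forall n c, integrable (gibbs N (shrink delta N n)) (fun _ => c))
      by (intros; now apply integrable_const, gibbs_summable).
    assert (Ec : forall n c, gibbsE N (shrink delta N n) (fun _ => c) = c)
      by (intros; apply Ex_const; auto using gibbs_summable, gibbs_pos).
    assert (IGn : forall (f : nat -> R) n,
      integrable (gibbs N (shrink delta N n)) (fun x => f (coord (snoc x n) N))).
    { intros f n. apply summable_ext with (2 := IC n (f n)). intros x. now rewrite coord_snoc_last. }
    assert (EGn : forall (f : nat -> R) n,
      gibbsE N (shrink delta N n) (fun x => f (coord (snoc x n) N)) = f n).
    { intros f n. rewrite <- (Ec n (f n)). apply Ex_ext. intros x. now rewrite coord_snoc_last. }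
    assert (EF : gibbsE (S N) delta F = gibbsE (S N) delta (fun x => g (coord x N))).
    { apply Rle_antisym; apply gibbsE_cond_le; auto; intros n; rewrite EGn; unfold g; lra. }
    set (c := sum_idx N (fun i => delta i + delta i ^ 2 / 4)).
    set (h := hstar (t / (1 - D))).
    assert (Hh : 0 <= h) by apply hstar_nonneg.
    assert (Ieg : integrable (gibbs (S N) delta) (fun x => exp (t * g (coord x N))))
      by (eapply cgrowth_integrable, exp_lip_cgrowth with (L := / (1 - D)); auto; lra).
    apply Rle_trans with (gibbsE (S N) delta (fun x => exp (c * h) * exp (t * g (coord x N)))).
    + apply gibbsE_cond_le; auto.
      * eapply cgrowth_integrable, exp_lip_cgrowth with (L := 1); auto; lra.
      * now apply integrable_scal.
      * intros n. eapply cgrowth_integrable, exp_lip_cgrowth with (L := 1); auto using snoc_lip; lra.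
      * intros n. apply (IGn (fun m => exp (c * h) * exp (t * g m))).
      * intros n. rewrite (EGn (fun m => exp (c * h) * exp (t * g m))).
        eapply Rle_trans; [apply IH with (D := D); auto using dob_le_shrink, snoc_lip|].
        rewrite Rplus_comm, exp_plus. apply Rmult_le_compat_r; [apply Rlt_le, exp_pos|].
        apply exp_le, Rmult_le_compat_r; auto. apply sum_idx_le. intros i _.
        pose proof (shrink_bounds delta N n i (Hd i)). nra.
    + unfold gibbsE at 1. rewrite Ex_scal by auto. fold (gibbsE (S N) delta (fun x => exp (t * g (coord x N)))).
      rewrite sum_idx_S. fold c. rewrite EF.
      replace (t * _ + _) with (c * h + (t * gibbsE (S N) delta (fun x => g (coord x N))
        + (delta N + delta N ^ 2 / 4) * h)) by ring.
      rewrite exp_plus. apply Rmult_le_compat_l; [apply Rlt_le, exp_pos|].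
      now apply last_laplace.
Qed.

End Gibbs.

(** * The transport inequality *)

Lemma fold_prodn N f : fold_right Rmult 1 (map f (seq 0 N)) = prodn N f.
Proof.
  assert (H : forall l r, fold_right Rmult r l = fold_right Rmult 1 l * r).
  { induction l as [|x l IH]; intros r; simpl; [ring|]. rewrite IH. ring. }
  induction N as [|N IH]; [reflexivity|].
  rewrite seq_S, map_app, fold_right_app, H, IH. simpl. ring.
Qed.

Lemma fold_Rmax_ge l : 0 <= fold_right Rmax 0 l /\ forall x, In x l -> x <= fold_right Rmax 0 l.
Proof.
  induction l as [|y l [H0 H]]; simpl; [split; [lra|tauto]|]. split.
  - eapply Rle_trans; [exact H0|apply Rmax_r].
  - intros x [<-|Hx]; [apply Rmax_l|]. eapply Rle_trans; [apply H, Hx|apply Rmax_r].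
Qed.

(* [edge] and [act] are extended by neutral values to all indices, so that the hypotheses on the
   interaction and the activities need no range conditions. *)
Definition edge (N : nat) (gamma : nat -> nat -> ereal_nn) (i j : nat) : R :=
  if andb (Nat.ltb i N) (Nat.ltb j N) then exp_neg_mul (gamma i j) 1 else 1.

Definition act (N : nat) (delta : nat -> R) (i : nat) : R := if Nat.ltb i N then delta i else 0.

Lemma exp_neg_mul_pow g k : exp_neg_mul g k = exp_neg_mul g 1 ^ k.
Proof.
  destruct g as [r|]; simpl.
  - rewrite Rmult_1_r, <- exp_INR_mul. f_equal. ring.
  - destruct k; simpl; ring.
Qed.

Lemma edge_lt N gamma i j : (i < N)%nat -> (j < N)%nat -> edge N gamma i j = exp_neg_mul (gamma i j) 1.
Proof. intros Hi Hj. unfold edge. apply Nat.ltb_lt in Hi, Hj. now rewrite Hi, Hj. Qed.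

Lemma act_lt N delta i : (i < N)%nat -> act N delta i = delta i.
Proof. intros Hi. unfold act. apply Nat.ltb_lt in Hi. now rewrite Hi. Qed.

(** The Poisson normalisations [exp (- delta i)] factor out and later cancel against [C]. The
    induction runs over [M <= N] while [edge] and [act] keep the range [N]. *)
Lemma gibbs_weight_gibbs N delta gamma (x : config N) :
  gibbs_weight N delta gamma x = exp (- sum_idx N delta) * gibbs (edge N gamma) N (act N delta) x.
Proof.
  unfold gibbs_weight, gibbs. rewrite !fold_prodn.
  assert (H : forall M, (M <= N)%nat ->
    prodn M (fun j => fold_right Rmult 1
      (map (fun i => exp_neg_mul (gamma i j) (coord x i * coord x j)) (seq 0 j)))
    * prodn M (fun i => poisson (delta i) (coord x i))
    = exp (- sum_idx M delta) * gw (edge N gamma) M (act N delta) (coord x)); [|now apply H].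
  induction M as [|M IH]; intros HM.
  - unfold sum_idx. simpl. rewrite Ropp_0, exp_0. ring.
  - simpl. rewrite fold_prodn, sum_idx_S, Ropp_plus_distr, exp_plus.
    rewrite (prodn_ext M (fun i => edge N gamma i M ^ (coord x i * coord x M))
      (fun i => exp_neg_mul (gamma i M) (coord x i * coord x M)))
      by (intros; rewrite edge_lt, <- exp_neg_mul_pow by lia; reflexivity).
    set (p := prodn M (fun i => exp_neg_mul _ _)).
    rewrite act_lt by lia. unfold poisson at 2, pw.
    transitivity (prodn M (fun j => fold_right Rmult 1
      (map (fun i => exp_neg_mul (gamma i j) (coord x i * coord x j)) (seq 0 j)))
      * prodn M (fun i => poisson (delta i) (coord x i))
      * (p * (exp (- delta M) * delta M ^ coord x M / INR (fact (coord x M))))); [ring|].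
    rewrite IH by lia. unfold Rdiv. ring.
Qed.

(* Fenchel-Young for [q ln q - q] and [exp]; replaces the Donsker-Varadhan formula. *)
Lemma young_entropy q p g : 0 <= q -> 0 <= p -> (p = 0 -> q = 0) ->
  q * g <= (if Req_EM_T q 0 then 0 else q * ln (q / p)) - q + p * exp g.
Proof.
  intros Hq Hp H. pose proof (exp_pos g). destruct Req_EM_T as [->|Hq0]; [nra|].
  assert (Hp0 : 0 < p) by (destruct Hp as [Hp|<-]; [auto|exfalso; auto]).
  assert (Hq1 : 0 < q) by lra.
  pose proof (exp_ineq1_le (g - ln (q / p))) as Hy.
  assert (E1 : q * exp (g - ln (q / p)) = p * exp g).
  { unfold Rminus. rewrite exp_plus, exp_Ropp, exp_ln by now apply Rdiv_lt_0_compat. field. lra. }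
  rewrite <- E1. nra.
Qed.

Lemma glb_exists (S : R -> Prop) :
  (exists x, S x) -> (forall x, S x -> 0 <= x) -> exists m, is_glb S m.
Proof.
  intros [x Hx] H.
  destruct (completeness (fun r => S (- r))) as [m [Hub Hlub]].
  - exists 0. intros r Hr. specialize (H _ Hr). lra.
  - exists (- x). now rewrite Ropp_involutive.
  - exists (- m). split.
    + intros y Hy. assert (- y <= m); [|lra]. apply Hub. now rewrite Ropp_involutive.
    + intros b Hb. assert (m <= - b); [|lra]. apply Hlub. intros r Hr. specialize (Hb _ Hr). lra.
Qed.

(* [t = ln (1 + r / c)] attains the Legendre transform of [c * hstar]. *)
Lemma h_c_legendre c r : 0 < c -> 0 < r ->
  0 < ln (1 + r / c) /\ h_c c r = r * ln (1 + r / c) - c * hstar (ln (1 + r / c)).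
Proof.
  intros Hc Hr. assert (0 < r / c) by now apply Rdiv_lt_0_compat. split.
  - rewrite <- ln_1. apply ln_increasing; lra.
  - unfold h_c, h_fun, hstar. rewrite exp_ln by lra. field. lra.
Qed.

Theorem theorem3p3 (N : nat) (delta : nat -> R) (gamma : nat -> nat -> ereal_nn)
  (HN : (2 <= N)%nat)
  (Hdelta : forall i, (i < N)%nat -> 0 < delta i)
  (Hgnn : forall i j, (i < N)%nat -> (j < N)%nat ->
            match gamma i j with Some r => 0 <= r | None => True end)
  (Hgsym : forall i j, (i < N)%nat -> (j < N)%nat -> gamma i j = gamma j i)
  (Hgdiag : forall i, (i < N)%nat -> gamma i i = Some 0)
  (HD : dobrushin N delta gamma < 1)
  (C : R) (HC : has_sum (gibbs_weight N delta gamma) C) :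
  let P := fun x : config N => gibbs_weight N delta gamma x / C in
  let c := sum_idx N (fun i => delta i + delta i ^ 2 / 4) in
  forall Q : config N -> R, is_prob Q ->
  forall Hv : R, rel_entropy Q P Hv ->
  exists W : R, is_glb (W1_costs rhoH Q P) W /\
    h_c c ((1 - dobrushin N delta gamma) * W) <= Hv.
Proof.
  intros P c Q [HQ HQ1] Hv [Habs Hent].
  apply has_sum_HS in HQ1, Hent, HC.
  set (D := dobrushin N delta gamma) in *.
  set (a := edge N gamma). set (del := act N delta).
  assert (a_unit : forall i j, 0 <= a i j <= 1).
  { intros i j. unfold a, edge.
    destruct (Nat.ltb i N) eqn:Ei, (Nat.ltb j N) eqn:Ej; simpl; try lra.
    apply Nat.ltb_lt in Ei, Ej. generalize (Hgnn i j Ei Ej).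
    destruct (gamma i j) as [r|]; simpl; intros Hr; [|lra].
    split; [apply Rlt_le, exp_pos|]. rewrite Rmult_1_r, <- exp_0. apply exp_le. lra. }
  assert (a_sym : forall i j, a i j = a j i).
  { intros i j. unfold a, edge. rewrite Bool.andb_comm.
    destruct (Nat.ltb j N) eqn:Ej, (Nat.ltb i N) eqn:Ei; simpl; auto.
    apply Nat.ltb_lt in Ei, Ej. now rewrite Hgsym. }
  assert (a_diag : forall i, a i i = 1).
  { intros i. unfold a, edge. destruct (Nat.ltb i N) eqn:Ei; simpl; auto.
    apply Nat.ltb_lt in Ei. rewrite Hgdiag by auto. simpl. rewrite Rmult_0_l, Ropp_0. apply exp_0. }
  assert (Hdel : forall i, 0 <= del i).
  { intros i. unfold del, act. destruct (Nat.ltb i N) eqn:Ei; [|lra].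
    apply Nat.ltb_lt in Ei. now apply Rlt_le, Hdelta. }
  assert (HD0 : 0 <= D) by apply (proj1 (fold_Rmax_ge _)).
  assert (Hdob : dob_le a N del D).
  { intros j Hj. apply Rle_trans with (sum_idx N (fun i => delta i * one_minus_exp_neg (gamma i j))).
    - right. apply sum_idx_ext. intros i Hi. unfold a, del, one_minus_exp_neg.
      now rewrite act_lt, edge_lt.
    - apply (proj2 (fold_Rmax_ge _)). apply in_map_iff. exists j. split; auto. apply in_seq. lia. }
  set (u := gibbs a N del).
  assert (Hu : forall x, 0 <= u x) by (intros; now apply gibbs_nonneg).
  assert (Hus : summable u) by now apply gibbs_summable.
  assert (Hup : 0 < tsum u) by now apply gibbs_pos.
  set (Z := tsum u) in *.
  assert (HCZ : C = exp (- sum_idx N delta) * Z).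
  { apply (HS_unique (gibbs_weight N delta gamma)); auto.
    apply HS_ext with (fun x => exp (- sum_idx N delta) * u x).
    - intros x. symmetry. apply gibbs_weight_gibbs.
    - now apply HS_scal, summable_tsum. }
  assert (HP : forall x, P x = / Z * u x).
  { intros x. unfold P. rewrite gibbs_weight_gibbs, HCZ. fold a del u.
    pose proof (exp_pos (- sum_idx N delta)). field. lra. }
  assert (HZ : 0 < / Z) by now apply Rinv_0_lt_compat.
  assert (HP0 : forall x, 0 <= P x) by (intros; rewrite HP; apply Rmult_le_pos; auto; lra).
  assert (HPE : forall F, integrable u F -> HS (fun x => P x * F x) (gibbsE a N del F)).
  { intros F HF. apply HS_ext with (fun x => / Z * (u x * F x)); [intros; rewrite HP; ring|].
    unfold gibbsE, Ex. fold u Z. unfold Rdiv. rewrite Rmult_comm. now apply HS_scal, summable_tsum. }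
  assert (HP1 : HS P 1).
  { pose proof (HPE (fun _ => 1) (integrable_const u Hus 1)) as H1.
    unfold gibbsE in H1. rewrite Ex_const in H1 by auto.
    apply HS_ext with (2 := H1). intros; ring. }
  set (S := fun x => if Req_EM_T (Q x) 0 then 0 else Q x * ln (Q x / P x)) in *.
  assert (Hyoung : forall g x, Q x * g <= S x - Q x + P x * exp g)
    by (intros; apply young_entropy; auto).
  (* Summing the pointwise inequality; the [- 1] is the total mass of [Q]. *)
  assert (Hgibbs : forall (G : config N -> R) m s, HS (fun x => Q x * G x) m ->
    HS (fun x => P x * exp (G x)) s -> m <= Hv - 1 + s).
  { intros G m s Hm Hs. eapply HS_le; [|exact Hm|].
    2: apply HS_plus; [apply HS_minus; [exact Hent|exact HQ1]|exact Hs].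
    intros x. apply Hyoung. }
  (* Young's inequality with [g = tot x] bounds the first moment of [Q] by its entropy and an
     exponential moment of [P]: finite entropy yields finite transport cost. *)
  assert (HmQ : summable (fun x => Q x * rhoH x (origin N))).
  { assert (Hdom : forall x, 0 <= Q x * rhoH x (origin N) <= S x - Q x + P x * exp (1 * tot x)).
    { intros x. split; [apply Rmult_le_pos; auto using rhoH_nonneg|].
      rewrite rhoH_origin, Rmult_1_l. apply Hyoung. }
    eapply summable_dom; [|eapply HS_summable with (f := fun x => S x - Q x + P x * exp (1 * tot x))].
    - intros x. rewrite Rabs_pos_eq; apply Hdom.
    - intros x. eapply Rle_trans; apply Hdom.
    - apply HS_plus; [apply HS_minus; eassumption|]. apply HPE. now apply integrable_exp_tot. }
  assert (HintF : forall F, lipschitz rhoH 1 F -> integrable u F)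
    by (intros F HF; eapply cgrowth_integrable, lip_cgrowth with (L := 1); auto; lra).
  assert (Htot : lipschitz rhoH 1 (fun x : config N => rhoH x (origin N))).
  { intros x y. pose proof (rhoH_tri N x y (origin N)). lra. }
  assert (HQF : forall F, lipschitz rhoH 1 F -> HS (fun x => Q x * F x) (tsum (fun x => Q x * F x))).
  { intros F HF. apply summable_tsum, summable_dom with
      (fun x => Rabs (F (origin N)) * Q x + Q x * rhoH x (origin N)).
    - intros x. rewrite Rabs_mult, (Rabs_pos_eq (Q x)) by auto.
      pose proof (lipschitz_Rabs rhoH (rhoH_sym N) 1 F x (origin N) HF) as H1.
      pose proof (Rabs_triang (F (origin N)) (F x - F (origin N))) as H2.
      replace (F (origin N) + (F x - F (origin N))) with (F x) in H2 by ring.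
      specialize (HQ x). nra.
    - apply summable_plus; auto. apply summable_scal. eapply HS_summable; eauto. }
  assert (Hcc : c = sum_idx N (fun i => del i + del i ^ 2 / 4)).
  { apply sum_idx_ext. intros i Hi. unfold del. now rewrite act_lt. }
  assert (Hdual : forall t F, 0 <= t -> lipschitz rhoH 1 F ->
    (1 - D) * t * (tsum (fun x => Q x * F x) - tsum (fun x => P x * F x)) <= Hv + c * hstar t).
  (* The scale [s = (1 - D) t] makes [hstar t] appear in the Laplace bound. *)
  { intros t F Ht HF. set (s := (1 - D) * t). assert (Hs : 0 <= s) by (unfold s; nra).
    rewrite (HS_tsum _ _ (HPE F (HintF F HF))).
    pose proof (gibbsE_laplace a a_unit a_sym a_diag N del D s F Hdel (conj HD0 HD) Hdob Hs HF) as HL.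
    replace (s / (1 - D)) with t in HL by (unfold s; field; lra). rewrite <- Hcc in HL.
    set (k := s * gibbsE a N del F + c * hstar t) in HL.
    assert (Ie : integrable u (fun x => exp (s * F x)))
      by (eapply cgrowth_integrable, exp_lip_cgrowth with (L := 1); auto; lra).
    assert (H1 : s * tsum (fun x => Q x * F x) - k * 1 <= Hv - 1 + exp (- k) * gibbsE a N del (fun x => exp (s * F x))).
    (* Shifting by the logarithmic Laplace bound [k] makes the exponential integral at most 1, which
       cancels the [- 1]. *)
    { apply (Hgibbs (fun x => s * F x - k)).
      - apply HS_ext with (fun x => s * (Q x * F x) - k * Q x); [intros; ring|].
        apply HS_minus; apply HS_scal; auto.
      - apply HS_ext with (fun x => exp (- k) * (P x * exp (s * F x))).
        + intros x. unfold Rminus. rewrite exp_plus. ring.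
        + apply HS_scal. now apply HPE. }
    assert (H2 : exp (- k) * gibbsE a N del (fun x => exp (s * F x)) <= 1).
    { apply Rle_trans with (exp (- k) * exp k).
      - apply Rmult_le_compat_l; auto. apply Rlt_le, exp_pos.
      - rewrite <- exp_plus, Rplus_opp_l, exp_0. lra. }
    assert (Hk : k = s * gibbsE a N del F + c * hstar t) by reflexivity. clearbody k. lra. }
  assert (Hcoup : forall t, 0 < t -> forall eps, 0 < eps ->
    exists v, W1_costs rhoH Q P v /\ v <= (Hv + c * hstar t) / ((1 - D) * t) + eps).
  { intros t Ht eps Heps. assert (Hs : 0 < (1 - D) * t) by (apply Rmult_lt_0_compat; lra).
    destruct (kantorovich rhoH (origin N) (rhoH_nonneg N) (rhoH_refl N) (rhoH_sym N) (rhoH_tri N)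
      Q P _ _ ((Hv + c * hstar t) / ((1 - D) * t)) HQ HP0 HQ1 HP1
      (summable_tsum _ HmQ) (HPE _ (HintF _ Htot))) with (eps := eps)
      as (p & v & Hp & Hrow & Hcol & Hcost & Hle); auto.
    - intros F HF. apply Rmult_le_reg_l with ((1 - D) * t); auto.
      replace ((1 - D) * t * ((Hv + c * hstar t) / ((1 - D) * t))) with (Hv + c * hstar t)
        by (field; lra).
      apply Hdual; auto. lra.
    - exists v. split; auto. exists p. split; [split; [|split]|]; auto.
      + intros x. apply HS_has_sum; auto.
      + intros y. apply HS_has_sum; auto.
      + apply HS_has_sum; auto. intros; apply Rmult_le_pos; auto using rhoH_nonneg. }
  assert (Hcost0 : forall v, W1_costs rhoH Q P v -> 0 <= v).
  { intros v (p & (Hp & _) & Hcost). apply has_sum_HS in Hcost. eapply HS_nonneg; [|exact Hcost].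
    intros; apply Rmult_le_pos; auto using rhoH_nonneg. }
  destruct (glb_exists (W1_costs rhoH Q P)) as [W HW]; auto.
  (* Any values of [t] and [eps] show that some coupling has finite cost. *)
  { destruct (Hcoup 1 Rlt_0_1 1 Rlt_0_1) as (v & Hv' & _). eauto. }
  exists W. split; auto. destruct HW as [HW1 HW2].
  assert (HW0 : 0 <= W) by auto.
  assert (Hc : 0 < c).
  { unfold c. destruct N as [|M]; [lia|]. rewrite sum_idx_S.
    assert (0 <= sum_idx M (fun i => delta i + delta i ^ 2 / 4)).
    { apply sum_idx_nonneg. intros i Hi. specialize (Hdelta i ltac:(lia)). nra. }
    specialize (Hdelta M ltac:(lia)). nra. }
  (* For [W = 0] the optimal [t] would be 0, where the bound on [W] divides by zero. Then
     [h_c c 0 = 0], and [0 <= Hv] is [Hdual] at [t = 0]. *)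
  destruct HW0 as [HWp|<-].
  - set (r := (1 - D) * W).
    destruct (h_c_legendre c r Hc) as [Ht E1]; [apply Rmult_lt_0_compat; lra|].
    rewrite E1. set (t := ln (1 + r / c)) in *.
    assert (Hs : 0 < (1 - D) * t) by (apply Rmult_lt_0_compat; lra).
    assert (HWle : W <= (Hv + c * hstar t) / ((1 - D) * t)).
    { apply Rnot_lt_le. intros Hlt.
      (* Half the gap as error yields a coupling cheaper than [W]. *)
      destruct (Hcoup t Ht ((W - (Hv + c * hstar t) / ((1 - D) * t)) / 2)) as (v & Hc1 & Hc2); [lra|].
      specialize (HW1 v Hc1). lra. }
    apply (Rmult_le_compat_l ((1 - D) * t)) in HWle; [|lra].
    replace ((1 - D) * t * ((Hv + c * hstar t) / ((1 - D) * t))) with (Hv + c * hstar t) in HWle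
      by (field; lra).
    unfold r. lra.
  - rewrite Rmult_0_r. unfold h_c, h_fun, Rdiv. rewrite Rmult_0_l, Rplus_0_r, ln_1.
    pose proof (Hdual 0 (fun _ => 0) (Rle_refl 0)) as H0.
    rewrite hstar_0, !Rmult_0_r, Rmult_0_l, Rplus_0_r in H0.
    rewrite Rmult_0_r, Rminus_0_r, Rmult_0_r. apply H0. intros x y. pose proof (rhoH_nonneg N x y). lra.
Qed.
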